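(* Let $\mu = e^{v(r)}\,dx$, $r=|x|$, be a radially symmetric measure on $\mathbb{R}^d$ with increasing $v$, and let $r_0>0$. Assume that there exists a smooth function $f:[0,\infty)\to\mathbb{R}$ satisfying the following assumptions: 1) $|f|\le 1$; 2) $f(r_0)=1$; 3) the function $$F(r)=f'(r)+f(r)\Bigl(v'(r)+\frac{d-1}{r}\Bigr)$$ is increasing on $[0,\infty)$. Then among the open sets $A$ with Lipschitz boundary satisfying $\mu(A)=\mu(B_{r_0})$, the ball $B_{r_0}=\{|x|\le r_0\}$ has the minimal surface measure $\mu^{+}$; that is, $\mu^{+}(\partial A)\ge\mu^{+}(\partial B_{r_0})$ for every such $A$.
   Context: For a Borel measure $\mu$ on $\mathbb{R}^d$ and a Borel set $A$, the surface measure is $\mu^{+}(\partial A)=\liminf_{\varepsilon\to 0}\frac{\mu(A^\varepsilon)-\mu(A)}{\varepsilon}$, where $A^\varepsilon$ is the $\varepsilon$-neighborhood of $A$. If $\mu$ has a continuous density $\rho$, the surface measure is represented as $\mu^{+}=\rho\cdot\mathcal{H}^{d-1}$. Lipschitz boundary means that $\partial A$ is a finite union of graphs of Lipschitz functions. *)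

(* Defs.v *)
From HB Require Import structures.
From mathcomp Require Import all_boot all_order all_algebra.
From mathcomp Require Import all_classical all_reals all_analysis.
Import Order.TTheory GRing.Theory Num.Theory numFieldNormedType.Exports.

Set Implicit Arguments.
Unset Strict Implicit.
Unset Printing Implicit Defensive.

Local Open Scope classical_set_scope.
Local Open Scope ring_scope.

(* MathComp-Analysis puts the product topology on 'rV[R]_d but no
   sigma-algebra; we use the product sigma-algebra, which is the Borel one. *)
Definition rV_display : measure_display. Proof. exact: default_measure_display. Qed.

Section measurable_rV.
Context {R : realType} {d : nat}.

Definition rV_coord (i : 'I_d) (x : 'rV[R]_d) : measurableTypeR R := x ord0 i.

Let rV_set0 : g_sigma_preimage rV_coord set0.
Proof. exact: sigma_algebra0. Qed.

Let rV_setC A : g_sigma_preimage rV_coord A -> g_sigma_preimage rV_coord (~` A).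
Proof. exact: sigma_algebraC. Qed.

Let rV_bigcup (F : (set 'rV[R]_d)^nat) :
  (forall i, g_sigma_preimage rV_coord (F i)) ->
  g_sigma_preimage rV_coord (\bigcup_i F i).
Proof. exact: sigma_algebra_bigcup. Qed.

HB.instance Definition _ := @isMeasurable.Build rV_display 'rV[R]_d
  (g_sigma_preimage rV_coord) rV_set0 rV_setC rV_bigcup.

Lemma measurable_rV_coord (i : 'I_d) : measurable_fun [set: 'rV[R]_d] (rV_coord i).
Proof.
move=> _ Y mY; rewrite setTI; apply: sub_sigma_algebra => /=.
rewrite -bigcup_seq/=; exists i => /=; first by rewrite mem_index_enum.
by exists Y => //; rewrite setTI.
Qed.

Lemma measurable_fun_rV d' (T : measurableType d') (f : T -> 'rV[R]_d) :
  (forall i, measurable_fun [set: T] (rV_coord i \o f)) ->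
  measurable_fun [set: T] f.
Proof.
move=> mf _ Y mY; rewrite setTI.
suff : (g_sigma_preimage rV_coord : set (set 'rV[R]_d)) `<=`
    [set A | measurable (f @^-1` A)] by exact.
apply: smallest_sub.
  split => /=; first by rewrite preimage_set0.
  - by move=> A mA; rewrite setTD preimage_setC; exact: measurableC.
  - by move=> F mF; rewrite preimage_bigcup; exact: bigcupT_measurable.
move=> A; rewrite -bigcup_seq/= => -[i _ [B mB <-]].
rewrite setTI -comp_preimage -[X in measurable X]setTI.
exact: mf.
Qed.

End measurable_rV.

Section lebesgue_measure_rV.
Context {R : realType}.
Local Open Scope ereal_scope.

Definition rV_cons {d} (p : measurableTypeR R * 'rV[R]_d) : 'rV[R]_d.+1 :=
  row_mx (p.1 : R)%:M p.2.

Lemma rV_cons0 d (p : measurableTypeR R * 'rV[R]_d) : rV_cons p ord0 ord0 = p.1.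
Proof.
transitivity (row_mx (p.1 : R)%:M p.2 ord0 (lshift d (ord0 : 'I_1))).
  by congr (row_mx _ _ _ _); exact/val_inj.
by rewrite row_mxEl mxE eqxx mulr1n.
Qed.

Lemma rV_consS d (p : measurableTypeR R * 'rV[R]_d) (j : 'I_d) :
  rV_cons p ord0 (lift ord0 j) = p.2 ord0 j.
Proof.
transitivity (row_mx (p.1 : R)%:M p.2 ord0 (rshift 1 j)).
  by congr (row_mx _ _ _ _); exact/val_inj.
by rewrite row_mxEr.
Qed.

Lemma measurable_rV_cons d : measurable_fun setT (@rV_cons d).
Proof.
apply: measurable_fun_rV => i; case: (unliftP ord0 i) => [j|] ->.
  rewrite (_ : _ \o _ = rV_coord j \o snd).
    by apply: measurableT_comp; [exact: measurable_rV_coord|exact: measurable_snd].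
  by apply/funext => p; exact: rV_consS.
rewrite (_ : _ \o _ = fst); first exact: measurable_fst.
by apply/funext => p; exact: rV_cons0.
Qed.

Section step.
Context {d : nat} (m : {sigma_finite_measure set 'rV[R]_d -> \bar R}).

(* Lebesgue measure on R^(d+1) from m = Lebesgue measure on R^d. *)
Definition lebesgue_rV_step : set 'rV[R]_d.+1 -> \bar R :=
  pushforward (lebesgue_measure \x m) (@rV_cons d).

HB.instance Definition _ := Measure.copy lebesgue_rV_step
  (measure_function_pushforward__canonical__measure_function_Measure
    (lebesgue_measure \x m) (@measurable_rV_cons d)).

Let lebesgue_rV_step_sigma_finite : sigma_finite setT lebesgue_rV_step.
Proof.
have /sigma_finiteP[F [TF ndF Foo]] := sigma_finiteT (@lebesgue_measure R).
have /sigma_finiteP[G [TG ndG Goo]] := sigma_finiteT m.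
pose h (x : 'rV[R]_d.+1) : measurableTypeR R * 'rV[R]_d :=
  (rV_coord ord0 x, rsubmx (x : 'rV[R]_(1 + d))).
have mh : measurable_fun setT h.
  apply/measurable_fun_pairP; split; first exact: measurable_rV_coord.
  apply: measurable_fun_rV => j.
  rewrite (_ : _ \o _ = rV_coord (rshift 1 j : 'I_d.+1)).
    exact: measurable_rV_coord.
  by apply/funext => x; rewrite /rV_coord /= mxE.
have hK p : h (rV_cons p) = p.
  by rewrite /h /rV_coord rV_cons0 /rV_cons row_mxKr; case: p.
exists (fun n => h @^-1` (F n `*` G n)).
  apply/esym; rewrite -subTset => x _.
  have [i _ Fi] : (\bigcup_i F i) (h x).1 by rewrite -TF.
  have [j _ Gj] : (\bigcup_j G j) (h x).2 by rewrite -TG.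
  exists (maxn i j) => //; split => /=.
    by move: Fi; exact/subsetPset/ndF/leq_maxl.
  by move: Gj; exact/subsetPset/ndG/leq_maxr.
move=> n; have [[mF Fn] [mG Gn]] := (Foo n, Goo n); split.
  by rewrite -[X in measurable X]setTI; apply: mh => //; exact: measurableX.
rewrite /lebesgue_rV_step /pushforward -comp_preimage.
rewrite (_ : h \o rV_cons = id) ?funeqE//.
rewrite [X in X < _](_ : _ = lebesgue_measure (F n) * m (G n)).
  by rewrite lte_mul_pinfty// ge0_fin_numE.
exact: product_measure1E.
Qed.

HB.instance Definition _ := Measure_isSigmaFinite.Build _ _ _
  lebesgue_rV_step lebesgue_rV_step_sigma_finite.

End step.

Fixpoint lebesgue_rV (d : nat) : {sigma_finite_measure set 'rV[R]_d -> \bar R} :=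
  match d with
  | 0%N => dirac (0%R : 'rV[R]_0)
  | d'.+1 => lebesgue_rV_step (lebesgue_rV d')
  end.

Lemma lebesgue_rV_box d (A : 'I_d -> set (measurableTypeR R)) :
  (forall i, measurable (A i)) ->
  lebesgue_rV d [set x | forall i, A i (x ord0 i)] =
  \prod_(i < d) lebesgue_measure (A i).
Proof.
elim: d A => [|d IHd] A mA.
  by rewrite big_ord0 /= diracE mem_set// => -[].
have mbox : measurable [set x : 'rV[R]_d | forall i, A (lift ord0 i) (x ord0 i)].
  rewrite (_ : mkset _ = \big[setI/setT]_(i < d)
      (rV_coord i @^-1` A (lift ord0 i))).
    apply: bigsetI_measurable => i _; rewrite -[X in measurable X]setTI.
    exact: measurable_rV_coord.
  by apply/seteqP; split => x /=; rewrite -bigcap_seq => xA i;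
    [move=> _|]; apply: xA; rewrite /= ?mem_index_enum.
rewrite big_ord_recl -IHd// -product_measure1E//.
rewrite /= /lebesgue_rV_step /pushforward.
congr (product_measure1 _ _ _); apply/seteqP; split => -[a y] /=.
  move=> Aay; split; first by have := Aay ord0; rewrite rV_cons0.
  by move=> i; have := Aay (lift ord0 i); rewrite rV_consS.
move=> [Aa Ay] i; case: (unliftP ord0 i) => [j|] ->.
  by rewrite rV_consS; exact: Ay.
by rewrite rV_cons0.
Qed.

End lebesgue_measure_rV.
Arguments lebesgue_rV {R} d.

Section isoperimetry.
Context {R : realType} {d : nat}.
Implicit Types (x y : 'rV[R]_d) (A G : set 'rV[R]_d).

Definition dotp x y : R := \sum_(i < d) x ord0 i * y ord0 i.

(* The norm `|x| of the library is the sup norm. *)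
Definition enorm x : R := Num.sqrt (dotp x x).

Definition eball (r : R) : set 'rV[R]_d := [set x | enorm x <= r].

Definition radial_measure (v : R -> R) A : \bar R :=
  (\int[lebesgue_rV d]_(x in A) (expR (v (enorm x)))%:E)%E.

Definition enlargement A (e : R) : set 'rV[R]_d :=
  [set x | exists2 a, A a & enorm (x - a) < e].

Definition surface_measure (mu : set 'rV[R]_d -> \bar R) A : \bar R :=
  limf_einf (fun e : R => ((mu (enlargement A e) - mu A) * (e^-1)%:E)%E) 0^'+.

Definition boundary A : set 'rV[R]_d := closure A `\` interior A.

(* Graph, in the direction of a unit vector u, of a Lipschitz function g
   defined on a subset D of the hyperplane orthogonal to u. *)
Definition lipschitz_graph G :=
  exists (u : 'rV[R]_d) (D : set 'rV[R]_d) (g : 'rV[R]_d -> R) (k : R),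
    [/\ enorm u = 1,
        forall y, D y -> dotp y u = 0,
        forall y z, D y -> D z -> `|g y - g z| <= k * enorm (y - z) &
        G = [set y + g y *: u | y in D]].

Definition lipschitz_boundary A :=
  exists (n : nat) (G : 'I_n -> set 'rV[R]_d),
    (forall i, lipschitz_graph (G i)) /\ boundary A = \bigcup_i G i.

End isoperimetry.
Arguments eball {R} d r.

(* Smoothness on the closed half-line: existence of a smooth extension to R;
   the values of f on negative reals are irrelevant. *)
Definition smooth_halfline {R : realType} (f : R -> R) :=
  exists2 g : R -> R, (forall n x, derivable g^`(n)%classic x 1) &
    (forall r, 0 <= r -> f r = g r).

(* Main.v *)
Require Import Defs.
From mathcomp Require Import all_boot all_order all_algebra.
From mathcomp Require Import all_classical all_reals all_analysis.
From mathcomp Require Import measurable_realfun ring lra.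
Import Order.TTheory GRing.Theory Num.Theory numFieldNormedType.Exports.
Local Open Scope classical_set_scope.
Local Open Scope ring_scope.

(** The vector field f(|x|) x / |x| calibrates the ball: it has norm at most 1,
   it equals the outer normal on the sphere of radius r0, and its divergence with
   respect to mu is F(|x|). The divergence theorem then gives, for a competitor A,
   mu+(boundary A) >= int_A F dmu, with equality for the ball B. As F is at most
   c = F(r0) inside B and at least c outside, and mu(A) = mu(B), the integral over
   A is at least the integral over B.

   To reach the liminf that defines mu+, the quotient (mu(A^e) - mu(A)) / e is
   bounded below for every small e, by testing the field against the tent function
   phi = (1 - dist(., A) / e')^+ with e' < e: for open A it is 1/e'-Lipschitz and
   constant off the collar between A and A^e (tent_flux_le).

   In place of the divergence theorem the proof uses dilations, which suit a
   radial field: as dx / |x|^d is dilation invariant, the increment of phi along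
   x -> x / (1 + h) can be exchanged for an increment of the radial profile of
   the field (dilation_by_parts). Letting h tend to 0 gives the integration by
   parts formula for arbitrary bounded measurable phi. With the tent it bounds the
   flux of A from above by its collar, and with the indicator of B it identifies
   the surface measure of the ball (surface_ball_le). The two are compared
   pointwise in pointwise_compare.

   The profile is first multiplied by a C^1 window supported in [s, 2T], because
   A may be unbounded and the field is singular at 0. Letting s -> 0 loses
   nothing in dimension d >= 2. In dimension 1 the field jumps by 2 f(0) at the
   origin; this helps A if f(0) <= 0, and is accounted for if 0 lies in the closure
   of A. In the remaining case A is first replaced by a set that contains the
   origin, has larger measure and smaller collars (fill_gap); this is where
   monotonicity of the density is used geometrically. The larger measure does no
   harm because c >= 0. *)

(** * The Euclidean norm on row vectors *)

Section euclidean.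
Context {R : realType} {d : nat}.
Implicit Types (x y z : 'rV[R]_d) (a t : R).

Lemma dotpC x y : dotp x y = dotp y x.
Proof. by apply: eq_bigr => i _; rewrite mulrC. Qed.

Lemma dotpDl x y z : dotp (x + y) z = dotp x z + dotp y z.
Proof. by rewrite /dotp -big_split; apply: eq_bigr => i _; rewrite mxE mulrDl. Qed.

Lemma dotpZl a x y : dotp (a *: x) y = a * dotp x y.
Proof. by rewrite /dotp mulr_sumr; apply: eq_bigr => i _; rewrite mxE mulrA. Qed.

Lemma dotpDr x y z : dotp x (y + z) = dotp x y + dotp x z.
Proof. by rewrite dotpC dotpDl !(dotpC x). Qed.

Lemma dotpZr a x y : dotp x (a *: y) = a * dotp x y.
Proof. by rewrite dotpC dotpZl dotpC. Qed.

Lemma dotpp_ge0 x : 0 <= dotp x x.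
Proof. by apply: sumr_ge0 => i _; rewrite -expr2 sqr_ge0. Qed.

Lemma enorm_ge0 x : 0 <= enorm x.
Proof. exact: sqrtr_ge0. Qed.

Lemma enorm_sqr x : enorm x ^+ 2 = dotp x x.
Proof. by rewrite sqr_sqrtr// dotpp_ge0. Qed.

Lemma le_coord_enorm x i : `|x ord0 i| <= enorm x.
Proof.
rewrite -sqrtr_sqr ler_wsqrtr// /dotp (bigD1 i)//= -expr2 lerDl.
by apply: sumr_ge0 => j _; rewrite -expr2 sqr_ge0.
Qed.

Lemma enorm_eq0 x : (enorm x == 0) = (x == 0).
Proof.
apply/eqP/eqP => [x0|->]; last first.
  by rewrite /enorm /dotp big1 ?sqrtr0// => i _; rewrite mxE mul0r.
apply/rowP => i; rewrite mxE; apply/eqP; rewrite -normr_le0 -x0.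
exact: le_coord_enorm.
Qed.

Lemma enorm0 : enorm (0 : 'rV[R]_d) = 0.
Proof. by apply/eqP; rewrite enorm_eq0. Qed.

Lemma enormZ a x : enorm (a *: x) = `|a| * enorm x.
Proof.
by rewrite /enorm dotpZl dotpZr mulrA -expr2 sqrtrM ?sqr_ge0// sqrtr_sqr.
Qed.

Lemma enormN x : enorm (- x) = enorm x.
Proof. by rewrite -scaleN1r enormZ normrN1 mul1r. Qed.

Lemma enormB x y : enorm (x - y) = enorm (y - x).
Proof. by rewrite -enormN opprB. Qed.

(** Expand the nonnegative square of |y| x - |x| y. *)
Lemma cauchy_schwarz x y : dotp x y <= enorm x * enorm y.
Proof.
have [/eqP x0|xn0] := boolP (enorm x == 0).
  rewrite x0 mul0r; move/eqP: x0; rewrite enorm_eq0 => /eqP ->.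
  by rewrite -(scale0r (0 : 'rV[R]_d)) dotpZl mul0r.
have [/eqP y0|yn0] := boolP (enorm y == 0).
  rewrite y0 mulr0; move/eqP: y0; rewrite enorm_eq0 => /eqP ->.
  by rewrite -(scale0r (0 : 'rV[R]_d)) dotpZr mul0r.
have x0 : 0 < enorm x by rewrite lt_def xn0 enorm_ge0.
have y0 : 0 < enorm y by rewrite lt_def yn0 enorm_ge0.
have := dotpp_ge0 (enorm y *: x + (- enorm x) *: y).
rewrite dotpDl !dotpDr !dotpZl !dotpZr (dotpC y x) -!enorm_sqr => h.
have {}h : 0 <= 2 * (enorm x * enorm y) * (enorm x * enorm y - dotp x y).
  by apply: le_trans h _; rewrite le_eqVlt; apply/orP; left; apply/eqP; ring.
by move: h; rewrite pmulr_rge0 ?subr_ge0// !mulr_gt0.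
Qed.

Lemma enormD x y : enorm (x + y) <= enorm x + enorm y.
Proof.
rewrite -(@ler_pXn2r _ 2) ?nnegrE ?addr_ge0 ?enorm_ge0//.
rewrite enorm_sqr dotpDl !dotpDr (dotpC y x) sqrrD !enorm_sqr.
have := cauchy_schwarz x y; lra.
Qed.

Lemma enorm_triangle z x y : enorm (x - y) <= enorm (x - z) + enorm (z - y).
Proof. by rewrite -(subrKA z) enormD. Qed.

Lemma enorm_continuous : continuous (@enorm R d).
Proof.
move=> x; apply: (@continuous_comp _ _ _ (fun y => dotp y y) Num.sqrt).
  apply: (@continuous_big _ _ _ _ predT add_continuous 'rV[R]_d _
    (fun i y => y ord0 i * y ord0 i)).
  move=> i _ y; have c := @coord_continuous R 1 d ord0 i y.
  exact: (@continuousM R _ _ _ y c c).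
exact: sqrt_continuous.
Qed.

(** The topology of row vectors comes from the sup norm; the two norms are
   comparable, so Euclidean balls form a neighbourhood basis too. *)
Lemma nbhs_enormP x (A : set 'rV[R]_d) :
  nbhs x A <-> exists2 e, 0 < e & forall y, enorm (y - x) < e -> A y.
Proof.
split=> [/nbhs_ballP[e /= e0 eA]|[e e0 eA]].
  exists e => // y yx; apply: eA; split => // i j.
  rewrite /ball/= (ord1 i) distrC.
  by apply: le_lt_trans yx; have := le_coord_enorm (y - x) j; rewrite !mxE.
have : (fun y => enorm (y - x)) @ x --> 0.
  rewrite -[X in _ --> X]enorm0 -(subrr x).
  apply: (@continuous_comp _ _ _ (fun y => y - x) (@enorm R d)).
    apply: (@continuousB R).
      by move=> V; exact.
    exact: (@cst_continuous 'rV[R]_d 'rV[R]_d).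
  exact: enorm_continuous.
move/cvgr0_norm_lt => /(_ _ e0); apply: filterS => y.
by rewrite ger0_norm ?enorm_ge0//; exact: eA.
Qed.

Lemma open_enormP (A : set 'rV[R]_d) : open A <->
  forall x, A x -> exists2 e, 0 < e & forall y, enorm (y - x) < e -> A y.
Proof.
rewrite openE; split => [oA x /oA|h x /h].
  by rewrite /interior => /nbhs_enormP.
by move=> ?; apply/nbhs_enormP.
Qed.

(** An open set is the union of the cubes with rational centre and radius
   1/(n+1) that it contains, and there are countably many of them. *)
Lemma open_measurable_rV (A : set 'rV[R]_d) : open A -> measurable A.
Proof.
move=> oA.
pose box (qn : 'rV[rat]_d * nat) : set 'rV[R]_d :=
  [set x | forall i, `|x ord0 i - ratr (qn.1 ord0 i)| < qn.2.+1%:R^-1].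
have mbox qn : measurable (box qn).
  rewrite (_ : box qn = \big[setI/setT]_(i < d)
      (rV_coord i @^-1` [set t : R | `|t - ratr (qn.1 ord0 i)| < qn.2.+1%:R^-1])).
    apply: bigsetI_measurable => i _; rewrite -[X in measurable X]setTI.
    apply: measurable_rV_coord => //.
    rewrite (_ : mkset _ = ball (ratr (qn.1 ord0 i) : R) qn.2.+1%:R^-1).
      by apply: open_measurable; exact: ball_open.
    by apply/seteqP; split => t; rewrite /ball/= distrC.
  by apply/seteqP; split => x /=; rewrite -bigcap_seq => xA i;
    [move=> _|]; apply: xA; rewrite /= ?mem_index_enum.
have -> : A = \bigcup_qn (if `[< box qn `<=` A >] then box qn else set0).
  apply/seteqP; split => [x Ax|x [qn _]]; last first.
    by case: asboolP => // qnA; exact: qnA.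
  have /nbhs_ballP[e /= e0 eA] : nbhs x A by move: oA; rewrite openE => /(_ _ Ax).
have [n ne] : exists n : nat, n.+1%:R^-1 < e / 2.
    by have [|n] := @ltr_add_invr R 0 (e / 2); [exact: divr_gt0|rewrite add0r; exists n].
  have n0 : 0 < n.+1%:R^-1 :> R by rewrite invr_gt0.
  have /choice[q hq] : forall i, exists q : rat, `|x ord0 i - ratr q| < n.+1%:R^-1.
    move=> i; have [|q] := @rat_in_itvoo R (x ord0 i - n.+1%:R^-1) (x ord0 i + n.+1%:R^-1).
      by rewrite ltrBlDr -addrA ltrDl addr_gt0.
    rewrite in_itv/= => /andP[q1 q2]; exists q.
    by rewrite ltr_distl ltrBlDr q2 -ltrBlDr q1.
  exists (\row_i q i, n) => //; case: asboolP => [_ i|]; first by rewrite mxE.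
  case=> y yb.
  apply: eA; split => // i j; rewrite (ord1 i) /ball/=.
  have := yb j; have := hq j; rewrite /= mxE => h1 h2.
  rewrite -(subrKA (ratr (q j))) (le_lt_trans (ler_normD _ _))//.
  rewrite (splitr e) ltrD// (lt_trans _ ne)// distrC; exact.
by apply: countable_bigcupT_measurable => // qn; case: asboolP.
Qed.

End euclidean.

(** * Lebesgue measure under dilations *)

Section dilation.
Context {R : realType}.
Local Open Scope ereal_scope.

(** Both sides integrate f against the same measure: the image of mu by g is
   c mu. *)
Lemma ge0_integral_scaled_pushforward {dX} {X : measurableType dX}
    (mu : {measure set X -> \bar R}) (g : X -> X) (c : {nonneg R}) (f : X -> \bar R) :
  measurable_fun setT g ->
  (forall A, measurable A -> mu (g @^-1` A) = c%:num%:E * mu A) ->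
  measurable_fun setT f -> (forall x, 0 <= f x) ->
  \int[mu]_x f (g x) = c%:num%:E * \int[mu]_x f x.
Proof.
move=> mg mug mf f0.
rewrite -ge0_integral_mscale// -[LHS](@ge0_integral_pushforward _ _ _ _ _ _ mg mu setT f)//.
apply: (@eq_measure_integral _ _ _ _ (mscale c mu)
  (measure_function_pushforward__canonical__measure_function_Measure mu mg)).
by move=> A mA _; exact: mug.
Qed.

Lemma lebesgue_measure_dilation (t : R) (A : set (measurableTypeR R)) :
  (0 < t)%R -> measurable A ->
  lebesgue_measure ((fun a : measurableTypeR R => t * a)%R @^-1` A)
  = (t^-1)%:E * lebesgue_measure A.
Proof.
move=> t0 mA.
have mt : measurable_fun setT (fun a : measurableTypeR R => t * a : measurableTypeR R)%R.
  exact: mulrl_measurable.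
have tge0 : (0 <= t)%R by exact: ltW.
pose m := mscale (NngNum tge0)
  (measure_function_pushforward__canonical__measure_function_Measure
    (@lebesgue_measure R) mt).
have ->// : lebesgue_measure A = m A.
  apply: lebesgue_measure_unique mA => _ [[a b] _ <-] /=; rewrite /m /mscale/= /pushforward.
  rewrite (_ : _ @^-1` _ = `]a / t, b / t]%classic)%R; last first.
    apply/seteqP; split => x /=; rewrite !in_itv/=.
      by rewrite ltr_pdivrMr// ler_pdivlMr// !(mulrC t).
    by rewrite ltr_pdivrMr// ler_pdivlMr// !(mulrC t).
  rewrite !lebesgue_measure_itv/= !lte_fin ltr_pM2r ?invr_gt0//.
  case: ifP => _; last by rewrite mule0.
  by rewrite -!EFinB -EFinM -mulrBl mulrCA divff ?mulr1// gt_eqF.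
by rewrite /m /mscale/= muleA -EFinM mulVf ?mul1e// gt_eqF.
Qed.

Lemma measurable_scaler d (t : R) : measurable_fun setT ( *:%R t : 'rV[R]_d -> 'rV[R]_d).
Proof.
apply: measurable_fun_rV => i.
rewrite (_ : _ \o _ = (fun a => t * a)%R \o rV_coord i).
  by apply: measurableT_comp; [exact: mulrl_measurable|exact: measurable_rV_coord].
by apply/funext => x; rewrite /rV_coord/= mxE.
Qed.

Lemma rV_consZ d (t : R) (p : measurableTypeR R * 'rV[R]_d) :
  rV_cons ((t * p.1)%R : measurableTypeR R, t *: p.2) = t *: rV_cons p.
Proof.
apply/matrixP => k i; have -> : k = ord0 by rewrite (ord1 k); exact/val_inj.
rewrite [RHS]mxE; case: (unliftP ord0 i) => [j|] ->.
  by rewrite !rV_consS/= mxE.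
by rewrite !rV_cons0.
Qed.

(** Induction on the dimension: by Fubini the dilation acts on the first
   coordinate and on the others separately, each with its own factor. *)
Lemma lebesgue_rV_dilation d (t : R) (A : set 'rV[R]_d) : (0 < t)%R ->
  measurable A ->
  lebesgue_rV d ( *:%R t @^-1` A) = (t^-1 ^+ d)%:E * lebesgue_rV d A.
Proof.
move=> t0; elim: d A => [|d IHd] A mA.
  rewrite expr0 mul1e /=; congr (dirac _ _); apply/funext => x /=.
  by rewrite (thinmx0 (t *: x)) (thinmx0 x).
have mcA : measurable (@rV_cons R d @^-1` A).
  by rewrite -[X in measurable X]setTI; exact: measurable_rV_cons.
rewrite /= /lebesgue_rV_step /pushforward/= /product_measure1.
set B := rV_cons @^-1` A.
have -> : (lebesgue_rV d \o xsection (rV_cons @^-1` ( *:%R t @^-1` A))) =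
   (fun a : measurableTypeR R => ((t^-1) ^+ d)%:E * lebesgue_rV d (xsection B (t * a)%R)).
  apply/funext => a /=; rewrite -IHd; last exact: measurable_xsection.
  congr (lebesgue_rV d _); apply/seteqP; split => y.
    rewrite /xsection/= !inE/= /B/= => h.
    by rewrite (rV_consZ _ t (a, y)).
  rewrite /xsection/= !inE/= /B/= => h.
  by rewrite -(rV_consZ _ t (a, y)).
have mB : measurable_fun setT (fun a : measurableTypeR R => lebesgue_rV d (xsection B a)).
  exact: measurable_fun_xsection.
have tge0 : (0 <= t^-1)%R by rewrite invr_ge0 ltW.
rewrite ge0_integralZl//; last 2 first.
  apply: (measurableT_comp mB); exact: mulrl_measurable.
  by rewrite lee_fin exprn_ge0.
rewrite (@ge0_integral_scaled_pushforward _ _ lebesgue_measure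
  (fun a : measurableTypeR R => t * a)%R (NngNum tge0) (fun a => lebesgue_rV d (xsection B a)))//.
- by rewrite muleA/= -EFinM exprSr.
- exact: mulrl_measurable.
- by move=> C mC; exact: lebesgue_measure_dilation.
Qed.

Lemma ge0_integral_dilation d (t : R) (f : 'rV[R]_d -> \bar R) : (0 < t)%R ->
  measurable_fun setT f -> (forall x, 0 <= f x) ->
  \int[lebesgue_rV d]_x f (t *: x) =
  (t^-1 ^+ d)%:E * \int[lebesgue_rV d]_x f x.
Proof.
move=> t0 mf f0.
have tge0 : (0 <= t^-1 ^+ d)%R by rewrite exprn_ge0// invr_ge0 ltW.
rewrite (@ge0_integral_scaled_pushforward _ _ (lebesgue_rV d) ( *:%R t) (NngNum tge0))//.
  exact: measurable_scaler.
by move=> A mA; exact: lebesgue_rV_dilation.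
Qed.

End dilation.

(** * Integrals of bounded functions of bounded support *)

Section bounded_compactly_supported.
Context {R : realType} {d : nat}.
Implicit Types (f g : 'rV[R]_d -> R).

Lemma continuous_measurable_rV f : continuous f -> measurable_fun setT f.
Proof.
move=> cf; apply: (measurability (@RGenOInfty.G R)) => [|_ [_ [a ->] <-]].
  exact: RGenOInfty.measurableE.
rewrite setTI; apply: open_measurable_rV.
by apply: open_comp => // x _; exact: cf.
Qed.

Lemma measurable_enorm : measurable_fun setT (@enorm R d).
Proof. by apply: continuous_measurable_rV; exact: enorm_continuous. Qed.

Lemma measurable_eball (T : R) : measurable (eball d T).
Proof.
rewrite (_ : eball d T = setT `&` (@enorm R d @^-1` `]-oo, T])).
  exact: measurable_enorm.
by apply/seteqP; split => x; rewrite /eball/= in_itv/= ?setTI//; case.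
Qed.

Lemma lebesgue_rV_eball_lty (T : R) : (lebesgue_rV d (eball d T) < +oo)%E.
Proof.
pose C := [set x : 'rV[R]_d | forall i, `[- T, T]%classic (x ord0 i)].
have mC : measurable C.
  rewrite (_ : C = \big[setI/setT]_(i < d) (rV_coord i @^-1` `[- T, T])).
    apply: bigsetI_measurable => i _; rewrite -[X in measurable X]setTI.
    exact: measurable_rV_coord.
  by apply/seteqP; split => x /=; rewrite -bigcap_seq => xA i;
    [move=> _|]; apply: xA; rewrite /= ?mem_index_enum.
apply: (@le_lt_trans _ _ (lebesgue_rV d C)).
  apply: le_measure; rewrite ?inE//; first exact: measurable_eball.
  move=> x xT i; rewrite /= in_itv/= -ler_norml.
  exact: le_trans (le_coord_enorm _ _) xT.
have -> : lebesgue_rV d C = (\prod_(i < d) @lebesgue_measure R `[(- T)%R, T]%classic)%E.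
  by rewrite -lebesgue_rV_box.
suff : (\prod_(i < d) @lebesgue_measure R `[(- T)%R, T]%classic)%E \is a fin_num.
  by rewrite fin_num_abs => /(le_lt_trans (lee_abs _)).
elim/big_ind : _ => //= [x y|i _]; first exact: fin_numM.
by rewrite lebesgue_measure_itv/=; case: ifP => _; rewrite -?EFinB.
Qed.

(** Signed integrals are only taken of such functions, so that integrability is
   never an issue. *)
Definition bounded_support (M T : R) f :=
  (forall x, `|f x| <= M) /\ (forall x, T < enorm x -> f x = 0).

Definition bsupp f := measurable_fun setT f /\ exists M T, bounded_support M T f.

Lemma bsupp_integrable f : bsupp f -> (lebesgue_rV d).-integrable setT (EFin \o f).
Proof.
move=> [mf [M [T [fM fT]]]].
have : (lebesgue_rV d).-integrable setT (EFin \o (f \_ (eball d T))).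
  rewrite -restrict_EFin; apply/(integrable_mkcond _ (measurable_eball T)).
  apply: measurable_bounded_integrable.
  - exact: measurable_eball.
  - exact: lebesgue_rV_eball_lty.
  - exact: measurable_funTS.
  - exists M; split; first exact: num_real.
    by move=> x xM y _ /=; apply: le_trans (fM y) _; exact: ltW.
rewrite (_ : f \_ _ = f)//; apply/funext => x; rewrite patchE.
by case: ifPn => //; rewrite notin_setE /eball/= => /negP; rewrite -ltNge => /fT ->.
Qed.

Lemma bsuppD f g : bsupp f -> bsupp g -> bsupp (fun x => f x + g x).
Proof.
move=> [mf [M [T [fM fT]]]] [mg [N [S [gN gS]]]]; split.
  exact: measurable_funD.
exists (M + N), (Num.max T S); split => x.
  by rewrite (le_trans (ler_normD _ _))// lerD.
by rewrite gt_max => /andP[xT xS]; rewrite fT// gS// addr0.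
Qed.

Lemma bsuppM f g M : bsupp f -> measurable_fun setT g -> (forall x, `|g x| <= M) ->
  bsupp (fun x => g x * f x).
Proof.
move=> [mf [N [T [fN fT]]]] mg gM; split; first exact: measurable_funM.
exists (M * N), T; split => x; first by rewrite normrM ler_pM.
by move=> xT; rewrite fT// mulr0.
Qed.

Lemma bsuppZ f a : bsupp f -> bsupp (fun x => a * f x).
Proof. by move=> bf; apply: (bsuppM _ _ `|a| bf). Qed.

Lemma bsuppN f : bsupp f -> bsupp (fun x => - f x).
Proof.
by move=> bf; have := bsuppZ _ (-1) bf; congr bsupp; apply/funext => x; rewrite mulN1r.
Qed.

Lemma bsuppB f g : bsupp f -> bsupp g -> bsupp (fun x => f x - g x).
Proof. by move=> bf bg; apply: bsuppD => //; exact: bsuppN. Qed.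

Lemma bsupp_dilation f (t : R) : 0 < t -> bsupp f -> bsupp (fun x => f (t *: x)).
Proof.
move=> t0 [mf [M [T [fM fT]]]]; split.
  by apply: (@measurableT_comp _ _ _ _ _ _ f) => //; exact: measurable_scaler.
exists M, (T / t); split => x // Tx; apply: fT.
by rewrite enormZ gtr0_norm// mulrC -ltr_pdivrMr.
Qed.

Definition volint f : R := (\int[lebesgue_rV d]_(x in setT) f x)%R.

Lemma volintE f : bsupp f -> (\int[lebesgue_rV d]_x (f x)%:E)%E = (volint f)%:E.
Proof.
by move=> /bsupp_integrable bf; rewrite /volint /Rintegral fineK//; exact: integrable_fin_num.
Qed.

Lemma volintD f g : bsupp f -> bsupp g ->
  volint (fun x => f x + g x) = volint f + volint g.
Proof. by move=> bf bg; apply: RintegralD => //; exact: bsupp_integrable. Qed.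

Lemma volintB f g : bsupp f -> bsupp g ->
  volint (fun x => f x - g x) = volint f - volint g.
Proof. by move=> bf bg; apply: RintegralB => //; exact: bsupp_integrable. Qed.

Lemma volintZ f a : bsupp f -> volint (fun x => a * f x) = a * volint f.
Proof. by move=> bf; apply: RintegralZl => //; exact: bsupp_integrable. Qed.

Lemma le_volint f g : bsupp f -> bsupp g -> (forall x, f x <= g x) ->
  volint f <= volint g.
Proof. by move=> bf bg fg; apply: le_Rintegral => //; exact: bsupp_integrable. Qed.

(** Dominated convergence; a common support of finite volume turns the common
   bound into an integrable one. *)
Lemma bounded_cvg_volint (f_ : nat -> 'rV[R]_d -> R) f M T :
  (forall n, measurable_fun setT (f_ n)) ->
  (forall n, bounded_support M T (f_ n)) ->
  (forall x, f_ ^~ x @ \oo --> f x) ->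
  volint (f_ n) @[n --> \oo] --> volint f.
Proof.
move=> mf_ bf_ f_f.
have mf : measurable_fun setT f by apply: measurable_fun_cvg => // x _; exact: f_f.
have bf : bounded_support M T f.
  split => x.
    have /cvg_norm h := f_f x.
    rewrite -(cvg_lim _ h)//; apply: limr_le; first by apply: cvgP h.
    by apply: nearW => n; exact: (bf_ n).1.
  move=> xT; rewrite -(cvg_lim _ (f_f x))//.
  apply: lim_near_cst; first exact: norm_hausdorff.
  by apply: nearW => n; exact: (bf_ n).2.
pose dom x := M * \1_(eball d T) x.
have bdom : bsupp dom.
  apply: bsuppZ; split; first by apply/measurable_indicP; exact: measurable_eball.
  exists 1, T; split => x; rewrite indicE; first by case: (_ \in _); rewrite ?normr1 ?normr0.
  by move=> xT; rewrite memNset// /eball/=; apply/negP; rewrite -ltNge.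
have : (\int[lebesgue_rV d]_(x in setT) (f_ n x)%:E @[n --> \oo] -->
    \int[lebesgue_rV d]_(x in setT) (f x)%:E)%E.
  apply: (@dominated_cvg _ _ _ _ setT measurableT (fun n x => (f_ n x)%:E)
     (fun x => (f x)%:E) (fun x => (dom x)%:E)).
  - by move=> n; exact/measurable_EFinP.
  - by move=> x _; apply: cvg_EFin; [exact: nearW|exact: f_f].
  - by [].
  - exact: (bsupp_integrable _ bdom).
  - move=> n x _; rewrite lee_fin /dom indicE.
    case: (boolP (x \in _)); first by move=> _; rewrite mulr1; exact: (bf_ n).1.
    rewrite notin_setE /eball/= => /negP; rewrite -ltNge mulr0 => /(bf_ n).2 ->.
    by rewrite normr0.
rewrite volintE; last by split => //; exists M, T.
move=> h; rewrite (_ : (fun n => _) = fine \o (fun n => \int[lebesgue_rV d]_x (f_ n x)%:E)%E)//.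
exact: fine_cvg h.
Qed.

(** Split into positive and negative parts. *)
Lemma volint_dilation f (t : R) : 0 < t -> bsupp f ->
  volint (fun x => f (t *: x)) = t^-1 ^+ d * volint f.
Proof.
move=> t0 bf; have mf := bf.1.
have mfE : measurable_fun setT (EFin \o f) by exact/measurable_EFinP.
have if_ := bsupp_integrable _ bf.
rewrite /volint /Rintegral integralE [in RHS]integralE.
rewrite (_ : (fun x => (f (t *: x))%:E)^\+%E = fun x => (EFin \o f)^\+%E (t *: x)); last first.
  exact: (funepos_comp (EFin \o f) ( *:%R t)).
rewrite (_ : (fun x => (f (t *: x))%:E)^\-%E = fun x => (EFin \o f)^\-%E (t *: x)); last first.
  exact: (funeneg_comp (EFin \o f) ( *:%R t)).
have fp := ge0_integral_dilation d t (EFin \o f)^\+%E t0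
  (measurable_funepos mfE) (funepos_ge0 _).
have fn := ge0_integral_dilation d t (EFin \o f)^\-%E t0
  (measurable_funeneg mfE) (funeneg_ge0 _).
rewrite fp fn.
have h1 := integrable_fin_num measurableT (integrable_funepos measurableT if_).
have h2 := integrable_fin_num measurableT (integrable_funeneg measurableT if_).
rewrite -muleBr//; last exact: fin_num_adde_defr.
by rewrite fineM// fin_numB h1.
Qed.

End bounded_compactly_supported.

(** * Integration by parts along dilations *)

Lemma bounded_derivative_lipschitz {R : realType} (U dU : R -> R) (M : R) :
  (forall r : R, is_derive r 1 U (dU r)) -> (forall r, `|dU r| <= M) ->
  forall a b, `|U a - U b| <= M * `|a - b|.
Proof.
move=> dU_ dUM a b; wlog ab : a b / a <= b.
  move=> h; have [/h//|/ltW/h] := leP a b.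
  by rewrite distrC (distrC b).
have cU : {within `[a, b], continuous U}.
  apply: continuous_subspaceT => x.
  by apply/differentiable_continuous/derivable1_diffP; case: (dU_ x).
have [c _ h] := MVT_segment ab (fun x _ => dU_ x) cU.
rewrite distrC h (distrC a) normrM ler_wpM2r// dUM//.
Qed.

Lemma eq_cvg_seq {R : realType} (u v : nat -> R) (l : R) :
  (forall n, u n = v n) -> v @ \oo --> l -> u @ \oo --> l.
Proof. by move=> /funext ->. Qed.

Lemma is_derive_seq {R : realType} (U : R -> R) (r dr : R) (u : nat -> R) :
  is_derive (r : R) 1 U dr -> (forall n, u n != 0) -> u n @[n --> \oo] --> 0 ->
  (U (r + u n) - U r) / u n @[n --> \oo] --> dr.
Proof.
move=> [dU <-] u0 ucvg.
have uc : u @ \oo --> 0^'.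
  move=> A /= /nbhs_ballP[e e0 eA]; have := (cvgr0_norm_lt _ ucvg) _ e0.
  case=> N _ hN; exists N => // n Nn /=.
  by apply: eA => //; rewrite /ball/= sub0r normrN; exact: hN.
have := cvg_comp _ _ uc dU.
rewrite /derive; apply: cvg_trans; apply: near_eq_cvg; apply: nearW => n /=.
by rewrite mulrC /GRing.scale/= mulr1 (addrC r).
Qed.

(** A derivative is a pointwise limit of difference quotients. *)
Lemma measurable_derivative {R : realType} (U dU : R -> R) :
  (forall r : R, is_derive r 1 U (dU r)) -> measurable_fun setT dU.
Proof.
move=> dU_; have mU : measurable_fun setT U.
  apply: continuous_measurable_fun => x.
  by apply/differentiable_continuous/derivable1_diffP; case: (dU_ x).
pose u (n : nat) : R := n.+1%:R^-1.
pose q n (r : R) := (U (r + u n) - U r) / u n.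
apply: (measurable_fun_cvg (h := q)).
  move=> n; apply: measurable_funM => //; apply: measurable_funB => //.
  apply: (@measurableT_comp _ _ _ _ _ _ U) => //.
  exact: measurable_funD.
move=> r _; apply: is_derive_seq => //; last exact: cvg_harmonic.
by move=> n; rewrite invr_eq0.
Qed.

Lemma measurable_enorm_exp_inv {R : realType} {d : nat} :
  measurable_fun setT (fun x : 'rV[R]_d => (enorm x ^+ d)^-1).
Proof.
rewrite (_ : (fun _ => _) = (fun a => a `^ (-1)) \o (fun x => enorm x ^+ d)).
  apply: measurableT_comp; first exact: measurable_powR.
  by apply: measurable_funX; exact: measurable_enorm.
by apply/funext => x /=; rewrite powR_inv1// exprn_ge0// enorm_ge0.
Qed.

Section by_parts.
Context {R : realType} {d : nat}.
Variables (U dU : R -> R) (M s T : R) (phi : 'rV[R]_d -> R) (h : nat -> R).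
Hypothesis s0 : 0 < s.
Hypothesis sT : s <= T.
Hypothesis U_s : forall r, r < s -> U r = 0.
Hypothesis U_T : forall r, T < r -> U r = 0.
Hypothesis dU_ : forall r : R, is_derive r 1 U (dU r).
Hypothesis dUM : forall r, `|dU r| <= M.
Hypothesis mphi : measurable_fun setT phi.
Hypothesis phi1 : forall x, `|phi x| <= 1.
Hypothesis h0 : forall n, 0 < h n.
Hypothesis h1 : forall n, h n <= 1.
Hypothesis hcvg : h n @[n --> \oo] --> 0.

Let M0 : 0 <= M. Proof. exact: le_trans (normr_ge0 _) (dUM 0). Qed.

Let T0 : 0 < T. Proof. exact: lt_le_trans sT. Qed.

Let continuousU : continuous U.
Proof.
move=> x; apply/differentiable_continuous/derivable1_diffP.
by case: (dU_ x).
Qed.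

Let measurableU t : measurable_fun setT (fun x : 'rV[R]_d => U (t * enorm x)).
Proof.
apply: (@measurableT_comp _ _ _ _ _ _ U).
  exact: continuous_measurable_fun.
apply: measurable_funM => //; exact: measurable_enorm.
Qed.

Let V (x : 'rV[R]_d) := (enorm x ^+ d)^-1.

Let measurableV : measurable_fun setT V.
Proof. exact: measurable_enorm_exp_inv. Qed.

Let V_ge0 x : 0 <= V x.
Proof. by rewrite invr_ge0 exprn_ge0// enorm_ge0. Qed.

Let le_V (t : R) x : 0 < t -> t <= enorm x -> V x <= (t ^+ d)^-1.
Proof.
move=> t0 tx; rewrite lef_pV2 ?posrE ?exprn_gt0//; last exact: lt_le_trans tx.
by apply: lerXn2r; rewrite ?nnegrE ?enorm_ge0// ltW.
Qed.

Lemma bsupp_radial_weight : bsupp (fun x : 'rV[R]_d => U (enorm x) / enorm x ^+ d).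
Proof.
split.
  apply: measurable_funM => //.
  by have := measurableU 1; under eq_fun do rewrite mul1r.
have K0 : 0 <= M * T * (s ^+ d)^-1.
  by apply: mulr_ge0; [apply: mulr_ge0 => //; exact: ltW|rewrite invr_ge0 exprn_ge0// ltW].
exists (M * T * (s ^+ d)^-1), T; split => x; last by move=> /U_T ->; rewrite mul0r.
have [xs|sx] := ltP (enorm x) s.
  by rewrite U_s// mul0r normr0.
have [Tx|xT] := ltP T (enorm x).
  by rewrite U_T// mul0r normr0.
rewrite normrM (ger0_norm (V_ge0 x)) ler_pM//; last exact: le_V.
have := bounded_derivative_lipschitz _ _ _ dU_ dUM (enorm x) 0.
rewrite (U_s 0)// !subr0 => /le_trans; apply; rewrite ler_wpM2l//.
by rewrite ger0_norm// enorm_ge0.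
Qed.

(** The substitute for the divergence theorem, applied to the field
   x U(|x|) / |x|^d. The measure dx / |x|^d is invariant under dilations, so
   the increment of phi along x -> x / (1 + h) can be moved to an increment of
   the radial profile U along r -> (1 + h) r; the latter is differentiable and
   dominated convergence applies. All the regularity is borne by U, so phi can be
   a Lipschitz function or an indicator alike. *)
Lemma dilation_by_parts :
  volint (fun x => (phi ((1 + h n)^-1 *: x) - phi x) / h n *
                   (U (enorm x) / enorm x ^+ d)) @[n --> \oo] -->
  volint (fun x => phi x * (enorm x * dU (enorm x) / enorm x ^+ d)).
Proof.
pose G (x : 'rV[R]_d) := U (enorm x) / enorm x ^+ d.
pose Q n (x : 'rV[R]_d) :=
  phi x * ((U ((1 + h n) * enorm x) - U (enorm x)) / h n / enorm x ^+ d).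
have l0 n : 0 < 1 + h n by rewrite addr_gt0.
have bG : bsupp G := bsupp_radial_weight.
have mphil n : measurable_fun setT (fun x : 'rV[R]_d => phi ((1 + h n)^-1 *: x)).
  by apply: (@measurableT_comp _ _ _ _ _ _ phi) => //; exact: measurable_scaler.
(* Substituting (1 + h n) x for x in the first term turns the increment of phi
   into one of U. *)
have E n : volint (fun x => (phi ((1 + h n)^-1 *: x) - phi x) / h n * G x) =
           volint (Q n).
  have b1 : bsupp (fun x => phi ((1 + h n)^-1 *: x) * G x).
    by apply: (bsuppM _ _ 1 bG).
  have b2 : bsupp (fun x => phi x * G x) by apply: (bsuppM _ _ 1 bG).
  have d1 := volint_dilation _ _ (l0 n) b1.
  have b3 : bsupp (fun x => phi ((1 + h n)^-1 *: ((1 + h n) *: x)) * G ((1 + h n) *: x)).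
    have -> : (fun x => phi ((1 + h n)^-1 *: ((1 + h n) *: x)) * G ((1 + h n) *: x)) =
        (fun x => phi x * G ((1 + h n) *: x)).
      by apply/funext => x; rewrite scalerA mulVf ?gt_eqF// scale1r.
    by apply: (bsuppM _ _ 1 _ mphi phi1); exact: bsupp_dilation.
  transitivity ((h n)^-1 * (volint (fun x => phi ((1 + h n)^-1 *: x) * G x)
                            - volint (fun x => phi x * G x))).
    rewrite -volintB// -volintZ; last exact: bsuppB.
    by congr volint; apply/funext => x; ring.
  have -> : volint (fun x => phi ((1 + h n)^-1 *: x) * G x) =
    (1 + h n) ^+ d * volint (fun x => phi ((1 + h n)^-1 *: ((1 + h n) *: x)) * G ((1 + h n) *: x)).
    by rewrite d1 mulrA -exprMn divff ?gt_eqF// expr1n mul1r.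
  rewrite -volintZ// -volintB//; last exact: bsuppZ.
  rewrite -volintZ; last by apply: bsuppB => //; exact: bsuppZ.
  congr volint; apply/funext => x; rewrite /Q /G.
  rewrite scalerA mulVf ?gt_eqF// scale1r enormZ gtr0_norm// exprMn invfM.
  have ln0 : (1 + h n) ^+ d != 0 by rewrite expf_neq0// gt_eqF.
  have h'0 : h n != 0 by rewrite gt_eqF.
  transitivity ((h n)^-1 * (phi x * U ((1 + h n) * enorm x) / enorm x ^+ d *
    ((1 + h n) ^+ d * ((1 + h n) ^+ d)^-1)
    - phi x * U (enorm x) / enorm x ^+ d)); first by ring.
  by rewrite divff// mulr1; ring.
under eq_fun do rewrite E.
apply: (@bounded_cvg_volint _ _ _ _ (M * T * ((s / 2) ^+ d)^-1) T).
- move=> n; apply: measurable_funM => //.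
  apply: measurable_funM => //; apply: measurable_funM => //.
  apply: measurable_funB; first exact: measurableU.
  by have := measurableU 1; under eq_fun do rewrite mul1r.
(* As h n <= 1, both values of U vanish when |x| < s / 2. *)
- move=> n; have K0 : 0 <= M * T / (s / 2) ^+ d.
    apply: mulr_ge0; first by apply: mulr_ge0 => //; exact: ltW.
    by rewrite invr_ge0 exprn_ge0// ltW// divr_gt0.
  split => x.
    have [Tx|xT] := ltP T (enorm x).
      rewrite /Q !U_T//; first by rewrite subrr !mul0r mulr0 normr0.
      by rewrite (lt_le_trans Tx)// ler_peMl ?enorm_ge0// lerDl ltW.
    have [xs|sx] := ltP (enorm x) (s / 2).
      have xs' : enorm x < s by rewrite (lt_le_trans xs)//; move: s0; lra.
      rewrite /Q !U_s//; first by rewrite subrr !mul0r mulr0 normr0.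
      rewrite (@le_lt_trans _ _ (2 * enorm x))//; last by rewrite mulrC -ltr_pdivlMr.
      by rewrite ler_wpM2r ?enorm_ge0//; have := h1 n; lra.
    rewrite /Q normrM -[leRHS]mul1r ler_pM// normrM (ger0_norm (V_ge0 x)).
    apply: ler_pM => //; last by apply: le_V => //; exact: divr_gt0.
    rewrite normrM normfV (gtr0_norm (h0 n)) ler_pdivrMr//.
    apply: (le_trans (bounded_derivative_lipschitz _ _ _ dU_ dUM _ _)).
    rewrite mulrDl mul1r addrAC subrr add0r -mulrA ler_wpM2l// ger0_norm.
      by rewrite mulrC ler_wpM2r// ltW.
    by rewrite mulr_ge0 ?enorm_ge0// ltW.
  move=> Tx; rewrite /Q !U_T//; first by rewrite subrr !mul0r mulr0.
  by rewrite (lt_le_trans Tx)// ler_peMl ?enorm_ge0// lerDl ltW.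
move=> x; apply: cvgM; first exact: cvg_cst.
apply: cvgM; last exact: cvg_cst.
have [x0|xn0] := eqVneq (enorm x) 0.
  rewrite x0 mul0r; under eq_fun do rewrite mulr0 subrr mul0r.
  exact: cvg_cst.
have u0 n : h n * enorm x != 0 by rewrite mulf_neq0// gt_eqF.
have uc : h n * enorm x @[n --> \oo] --> 0.
  by rewrite -(mul0r (enorm x)); apply: cvgMr_tmp.
have c := is_derive_seq _ _ _ _ (dU_ (enorm x)) u0 uc.
apply: eq_cvg_seq (@cvgMl_tmp _ _ _ _ _ (enorm x) _ c) => n.
rewrite (mulrDl 1) mul1r invfM.
transitivity ((U (enorm x + h n * enorm x) - U (enorm x)) / h n * (enorm x / enorm x)).
  by rewrite divff// mulr1.
by ring.
Qed.

End by_parts.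

(** * Continuously differentiable cutoffs *)

Section cutoffs.
Context {R : realType}.
Implicit Types (r t s T : R).

(** A second order error bound around x gives the derivative at x, without
   separating cases for a function defined by pieces. *)
Lemma is_derive_quadratic (f : R -> R) (x l K : R) : 0 <= K ->
  (forall z, `|f z - f x - l * (z - x)| <= K * (z - x) ^+ 2) -> is_derive x 1 f l.
Proof.
move=> K0 fK; apply/is_derive1_caratheodory.
exists (fun z => if z == x then l else (f z - f x) / (z - x)); split.
- move=> z; have [->|zx] := eqVneq z x; first by rewrite !subrr mulr0.
  by rewrite divfK// subr_eq0.
- rewrite /prop_for /continuous_at/= eqxx; apply/cvgrPdist_lt => e e0.
  have K1 : 0 < K + 1 by lra.
  near=> z; case: ifPn => [_|zx]; first by rewrite subrr normr0.
  have zx0 : 0 < `|z - x| by rewrite normr_gt0 subr_eq0.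
  rewrite distrC (@le_lt_trans _ _ (K * `|z - x|))//.
    rewrite -(ler_pM2r zx0) -normrM mulrBl divfK ?subr_eq0//.
    by rewrite -mulrA -expr2 real_normK ?num_real.
  rewrite (@le_lt_trans _ _ ((K + 1) * `|z - x|))//.
    by rewrite ler_wpM2r//; lra.
  rewrite mulrC -ltr_pdivlMr// distrC.
  by near: z; apply: cvgr_dist_lt; [exact: cvg_id|exact: divr_gt0].
- by rewrite eqxx.
Unshelve. all: by end_near. Qed.

Lemma is_derive_affine (f : R -> R) (x l : R) :
  (forall z, f z - f x = l * (z - x)) -> is_derive x 1 f l.
Proof.
move=> fl; apply: (is_derive_quadratic _ _ _ 0) => // z.
by rewrite fl subrr normr0 mul0r.
Qed.

Definition sqpos t : R := Num.max 0 t ^+ 2.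

Lemma is_derive_sqpos t : is_derive t 1 sqpos (2 * Num.max 0 t).
Proof.
apply: (is_derive_quadratic _ _ _ 1) => // z; rewrite mul1r /sqpos.
rewrite ler_norml; apply/andP.
have h1 := sqr_ge0 (z - t); have h2 := sqr_ge0 z; have h3 := sqr_ge0 t.
case: (leP 0 t) => t0; case: (leP 0 z) => z0.
- by split; nra.
- by have := mulr_ge0_le0 t0 (ltW z0); split; nra.
- by have := mulr_ge0_le0 z0 (ltW t0); split; nra.
- by split; nra.
Qed.

(** A cutoff that is merely piecewise affine would fail to be differentiable on
   whole spheres; composing squared positive parts gives a C^1 function equal
   to 1 on the negative numbers and to 0 beyond 1, with slope at most 4. *)
Definition cutoff t : R := sqpos (1 - sqpos t).

Definition dcutoff t : R := - (4 * Num.max 0 (1 - sqpos t) * Num.max 0 t).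

Lemma is_derive_cutoff t : is_derive t 1 cutoff (dcutoff t).
Proof.
have := is_derive_sqpos (1 - sqpos t).
have d1 : is_derive t 1 (fun u => 1 - sqpos u) (0 - 2 * Num.max 0 t).
  by apply: is_deriveB; exact: is_derive_sqpos.
move=> d2.
have -> : dcutoff t = 2 * Num.max 0 (1 - sqpos t) * (0 - 2 * Num.max 0 t).
  by rewrite /dcutoff; ring.
exact: (@is_derive1_comp _ sqpos (fun u => 1 - sqpos u) t _ _ d2 d1).
Qed.

Lemma cutoff_le0 t : t <= 0 -> cutoff t = 1.
Proof.
move=> t0; rewrite /cutoff /sqpos (max_idPl t0) expr0n/= subr0.
by rewrite max_r// expr1n.
Qed.

Lemma dcutoff_le0 t : t <= 0 -> dcutoff t = 0.
Proof. by move=> t0; rewrite /dcutoff (max_idPl t0) mulr0 oppr0. Qed.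

Lemma one_sub_sqpos_le0 t : 1 <= t -> Num.max 0 (1 - sqpos t) = 0.
Proof.
move=> t1; apply/max_idPl; rewrite /sqpos max_r; last by lra.
by nra.
Qed.

Lemma cutoff_ge1 t : 1 <= t -> cutoff t = 0.
Proof. by move=> t1; rewrite /cutoff {1}/sqpos one_sub_sqpos_le0// expr0n. Qed.

Lemma dcutoff_ge1 t : 1 <= t -> dcutoff t = 0.
Proof. by move=> t1; rewrite /dcutoff one_sub_sqpos_le0// mulr0 mul0r oppr0. Qed.

Lemma cutoff_ge0 t : 0 <= cutoff t.
Proof. exact: sqr_ge0. Qed.

Lemma cutoff_le1 t : cutoff t <= 1.
Proof.
rewrite /cutoff {1}/sqpos expr_le1//; last by rewrite le_max lexx.
by rewrite ge_max ler01/= lerBlDr lerDl sqr_ge0.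
Qed.

Lemma dcutoff_le t : dcutoff t <= 0.
Proof. by rewrite /dcutoff oppr_le0 !mulr_ge0// le_max lexx. Qed.

Lemma dcutoff_ge t : - 4 <= dcutoff t.
Proof.
rewrite /dcutoff lerN2; have [t1|t1] := leP 1 t.
  by rewrite one_sub_sqpos_le0// mulr0 mul0r.
have m0 : 0 <= Num.max 0 t by rewrite le_max lexx.
have m1 : Num.max 0 t <= 1 by rewrite ge_max ler01 ltW.
rewrite -mulrA ler_piMr//; apply: mulr_ile1 => //.
  by rewrite le_max lexx.
by rewrite ge_max ler01/= lerBlDr lerDl sqr_ge0.
Qed.

(** The window is 0 below s, 1 between 2 s and T, and 0 beyond 2 T. Staying away
   from the origin avoids the singularity of the field there, and staying
   bounded avoids any growth assumption on the density. *)
Definition rise s r : R := cutoff ((2 * s - r) / s).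
Definition drise s r : R := - (dcutoff ((2 * s - r) / s) / s).
Definition fall T r : R := cutoff ((r - T) / T).
Definition dfall T r : R := dcutoff ((r - T) / T) / T.

Lemma is_derive_rise s r : is_derive r 1 (rise s) (drise s r).
Proof.
have d1 : is_derive r 1 (fun r => (2 * s - r) / s) (- s^-1).
  by apply: is_derive_affine => z; ring.
rewrite /drise -mulrN.
exact: (@is_derive1_comp _ cutoff (fun r => (2 * s - r) / s) r _ _ (is_derive_cutoff _) d1).
Qed.

Lemma is_derive_fall T r : is_derive r 1 (fall T) (dfall T r).
Proof.
have d1 : is_derive r 1 (fun r => (r - T) / T) T^-1.
  by apply: is_derive_affine => z; ring.
exact: (@is_derive1_comp _ cutoff (fun r => (r - T) / T) r _ _ (is_derive_cutoff _) d1).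
Qed.

Lemma rise_le s r : 0 < s -> r <= s -> rise s r = 0.
Proof. by move=> s0 rs; apply: cutoff_ge1; rewrite ler_pdivlMr//; lra. Qed.

Lemma drise_le s r : 0 < s -> r <= s -> drise s r = 0.
Proof.
move=> s0 rs; rewrite /drise dcutoff_ge1 ?mul0r ?oppr0// ler_pdivlMr//; lra.
Qed.

Lemma rise_ge s r : 0 < s -> 2 * s <= r -> rise s r = 1.
Proof. by move=> s0 rs; apply: cutoff_le0; rewrite ler_pdivrMr//; lra. Qed.

Lemma drise_ge s r : 0 < s -> 2 * s <= r -> drise s r = 0.
Proof.
move=> s0 rs; rewrite /drise dcutoff_le0 ?mul0r ?oppr0// ler_pdivrMr//; lra.
Qed.

Lemma fall_le T r : 0 < T -> r <= T -> fall T r = 1.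
Proof. by move=> T0 rT; apply: cutoff_le0; rewrite ler_pdivrMr//; lra. Qed.

Lemma dfall_le T r : 0 < T -> r <= T -> dfall T r = 0.
Proof.
move=> T0 rT; rewrite /dfall dcutoff_le0 ?mul0r// ler_pdivrMr//; lra.
Qed.

Lemma fall_ge T r : 0 < T -> 2 * T <= r -> fall T r = 0.
Proof. by move=> T0 rT; apply: cutoff_ge1; rewrite ler_pdivlMr//; lra. Qed.

Lemma dfall_ge T r : 0 < T -> 2 * T <= r -> dfall T r = 0.
Proof.
move=> T0 rT; rewrite /dfall dcutoff_ge1 ?mul0r// ler_pdivlMr//; lra.
Qed.

Lemma drise_ge0 s r : 0 < s -> 0 <= drise s r.
Proof.
by move=> s0; rewrite /drise oppr_ge0 mulr_le0_ge0 ?dcutoff_le// invr_ge0 ltW.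
Qed.

Lemma drise_bound s r : 0 < s -> drise s r <= 4 / s.
Proof.
by move=> s0; rewrite /drise -mulNr ler_pM2r ?invr_gt0// lerNl dcutoff_ge.
Qed.

Lemma dfall_le0 T r : 0 < T -> dfall T r <= 0.
Proof. by move=> T0; rewrite /dfall mulr_le0_ge0 ?dcutoff_le// invr_ge0 ltW. Qed.

Lemma dfall_bound T r : 0 < T -> - (4 / T) <= dfall T r.
Proof.
by move=> T0; rewrite /dfall -mulNr ler_pM2r ?invr_gt0// dcutoff_ge.
Qed.

End cutoffs.

Section windows.
Context {R : realType}.
Variables (s T : R).
Hypotheses (s0 : 0 < s) (T0 : 0 < T).

Definition window r : R := rise s r * fall T r.
Definition dwindow r : R := drise s r * fall T r + rise s r * dfall T r.

Lemma is_derive_window (r : R) : is_derive r 1 window (dwindow r).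
Proof.
rewrite /dwindow addrC (mulrC (drise s r)).
exact: (@is_deriveM _ _ _ _ _ _ _ _ (is_derive_rise s r) (is_derive_fall T r)).
Qed.

Lemma window_ge0 r : 0 <= window r.
Proof. by rewrite mulr_ge0// cutoff_ge0. Qed.

Lemma window_le1 r : window r <= 1.
Proof. by rewrite mulr_ile1// ?cutoff_ge0 ?cutoff_le1. Qed.

Lemma window_le r : r <= s -> window r = 0.
Proof. by move=> rs; rewrite /window rise_le// mul0r. Qed.

Lemma dwindow_le r : r <= s -> dwindow r = 0.
Proof. by move=> rs; rewrite /dwindow drise_le// rise_le// !mul0r addr0. Qed.

Lemma window_ge r : 2 * T <= r -> window r = 0.
Proof. by move=> rT; rewrite /window fall_ge// mulr0. Qed.

Lemma dwindow_ge r : 2 * T <= r -> dwindow r = 0.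
Proof. by move=> rT; rewrite /dwindow dfall_ge// fall_ge// !mulr0 addr0. Qed.

Lemma dwindow_bound r : `|dwindow r| <= 4 / s + 4 / T.
Proof.
rewrite (le_trans (ler_normD _ _))// lerD// normrM.
  rewrite -[leRHS]mulr1 ler_pM// ger0_norm ?drise_ge0 ?drise_bound//.
    by rewrite cutoff_le1.
  exact: cutoff_ge0.
rewrite -[leRHS]mul1r ler_pM//; first by rewrite ger0_norm ?cutoff_ge0 ?cutoff_le1.
by rewrite ler0_norm ?dfall_le0// lerNl dfall_bound.
Qed.

End windows.

(** * The radial vector field *)

Section radial_field.
Context {R : realType} {d : nat}.
Variables (v f : R -> R).
Hypothesis d0 : (0 < d)%N.
Hypothesis v_nd : forall r s, 0 < r -> r <= s -> v r <= v s.
Hypothesis v_der : forall r, 0 < r -> derivable v r 1.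
Hypothesis f_der : forall r : R, derivable f r 1.
Hypothesis f_le1 : forall r, 0 <= r -> `|f r| <= 1.

(** The divergence, with respect to the weight e^v, of the field f(|x|) x / |x|. *)
Definition radial_div r : R := f^`()%classic r + f r * (v^`()%classic r + d.-1%:R / r).

Hypothesis F_nd : forall r s, 0 < r -> r <= s -> radial_div r <= radial_div s.

Definition density (x : 'rV[R]_d) : R := expR (v (enorm x)).

Lemma density_ge0 x : 0 <= density x.
Proof. exact: expR_ge0. Qed.

(** The values of v on negative numbers are arbitrary and so is v 0: only the
   restriction of v to the positive numbers is continuous. *)
Lemma measurable_density : measurable_fun setT density.
Proof.
apply: (@measurableT_comp _ _ _ _ _ _ expR); first exact: measurable_expR.
pose w (r : R) := if 0 < r then v r else v 0.
rewrite (_ : (fun x => _) = w \o @enorm R d); last first.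
  apply/funext => x /=; rewrite /w; case: ltP => // x0.
  by congr v; apply/eqP; rewrite eq_le x0 enorm_ge0.
apply: measurableT_comp; last exact: measurable_enorm.
apply: measurable_fun_if => //.
- exact: measurable_fun_ltr.
- rewrite setTI (_ : _ @^-1` _ = `]0, +oo[%classic); last first.
    by apply/seteqP; split => r /=; rewrite in_itv/= andbT.
  apply: subspace_continuous_measurable_fun => //.
  apply: continuous_in_subspaceT => r; rewrite inE/= in_itv/= andbT => r0.
  by apply/differentiable_continuous/derivable1_diffP; exact: v_der.
Qed.

Lemma continuous_field : continuous f.
Proof.
by move=> r; apply/differentiable_continuous/derivable1_diffP; exact: f_der.
Qed.

Variables (s T : R).
Hypotheses (s0 : 0 < s) (sT : s <= T).

Let T0 : 0 < T. Proof. exact: lt_le_trans sT. Qed.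

Let k := window s T.
Let dk := dwindow s T.

Definition flux r : R := k r * (r ^+ d.-1 * f r * expR (v r)).
Definition dflux r : R := (k r * radial_div r + dk r * f r) * (r ^+ d.-1 * expR (v r)).

Lemma flux_lt r : r < s -> flux r = 0.
Proof. by move=> rs; rewrite /flux /k window_le ?mul0r// ltW. Qed.

Lemma flux_gt r : 2 * T < r -> flux r = 0.
Proof. by move=> Tr; rewrite /flux /k window_ge ?mul0r// ltW. Qed.

Let sT2 : s <= 2 * T. Proof. by move: s0 sT; lra. Qed.

(** Below s the profile vanishes identically; above s this is the product rule. *)
Lemma is_derive_flux (r : R) : is_derive r 1 flux (dflux r).
Proof.
have [rs|sr] := ltP r s.
  have -> : dflux r = 0.
    by rewrite /dflux /k /dk window_le ?dwindow_le ?ltW// !mul0r addr0 mul0r.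
  apply: (@near_eq_is_derive _ _ _ (cst 0)).
  near=> z; rewrite /flux /k window_le ?mul0r//.
  by apply/ltW; near: z; exact: lt_nbhsl.
have r0 : 0 < r by exact: lt_le_trans sr.
have vd := v_der _ r0.
have dv : is_derive r 1 v (v^`()%classic r) by rewrite derive1E; exact: DeriveDef.
have df : is_derive r 1 f (f^`()%classic r) by rewrite derive1E; exact: DeriveDef (f_der r) _.
have de : is_derive r 1 (expR \o v) (expR (v r) * v^`()%classic r).
  exact: (@is_derive1_comp _ expR v r _ _ (is_derive_expR (v r)) dv).
have dp : is_derive r 1 (fun r : R => r ^+ d.-1) (d.-1%:R * r ^+ d.-1.-1).
  have := is_deriveX d.-1 (is_derive_id r (1 : R)).
  rewrite (_ : id ^+ d.-1 = (fun r : R => r ^+ d.-1)).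
    by move=> hd; apply: (is_derive_eq hd); rewrite /GRing.scale/= mulr1.
  by apply/funext => z; rewrite exprfctE.
have := is_deriveM (is_derive_window s T r) (is_deriveM (is_deriveM dp df) de).
move=> hd; apply: (is_derive_eq hd); rewrite /GRing.scale/= /dflux /radial_div.
have rd : r ^+ d.-1 * (d.-1%:R / r) = d.-1%:R * r ^+ d.-1.-1.
  case: (d.-1) => [|m]; first by rewrite mul0r mul0r mulr0.
  by rewrite /= exprS mulrCA mulrAC mulfV ?gt_eqF// mul1r.
rewrite mulrDr.
transitivity ((k r * f^`()%classic r + dk r * f r) * (r ^+ d.-1 * expR (v r)) +
   k r * f r * v^`()%classic r * (r ^+ d.-1 * expR (v r)) +
   k r * f r * (r ^+ d.-1 * (d.-1%:R / r)) * expR (v r)); last by ring.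
by rewrite rd !mulrfctE /k /dk /=; ring.
Unshelve. all: by end_near. Qed.

Definition windowed_div r : R := k r * radial_div r + dk r * f r.

Lemma windowed_div0 r : r <= s \/ 2 * T <= r -> windowed_div r = 0.
Proof.
by rewrite /windowed_div /k /dk => -[|] h;
  [rewrite window_le// dwindow_le//|rewrite window_ge// dwindow_ge//]; rewrite !mul0r addr0.
Qed.

(** Since the derivative of v is not assumed continuous, the bound comes from the
   monotonicity of the divergence, which squeezes it between its values at the
   ends of the window. *)
Lemma windowed_div_bound : exists C, forall r, `|windowed_div r| * expR (v r) <= C.
Proof.
exists ((`|radial_div s| + `|radial_div (2 * T)| + (4 / s + 4 / T)) * expR (v (2 * T))).
move=> r; have C0 : 0 <= (`|radial_div s| + `|radial_div (2 * T)| + (4 / s + 4 / T)).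
  by rewrite !addr_ge0// divr_ge0 ?ltW.
have [rs|sr] := leP r s.
  have -> : windowed_div r = 0 by apply: windowed_div0; left.
  by rewrite normr0 mul0r mulr_ge0// expR_ge0.
have [Tr|rT] := leP (2 * T) r.
  have -> : windowed_div r = 0 by apply: windowed_div0; right.
  by rewrite normr0 mul0r mulr_ge0// expR_ge0.
have r0 : 0 < r by exact: lt_trans sr.
rewrite ler_pM ?expR_ge0//; last by rewrite ler_expR v_nd// ltW.
rewrite (le_trans (ler_normD _ _))// lerD// normrM.
  rewrite -[leRHS]mul1r ler_pM//; first by rewrite ger0_norm ?window_ge0 ?window_le1.
  have h1 := F_nd _ _ s0 (ltW sr); have h2 := F_nd _ _ r0 (ltW rT).
  have n1 := ler_norm (radial_div (2 * T)).
  have n2 := ler_norm (- radial_div s); rewrite normrN in n2.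
  have n3 := normr_ge0 (radial_div (2 * T)).
  have n4 := normr_ge0 (radial_div s).
  by rewrite ler_norml; apply/andP; split; lra.
by rewrite -[leRHS]mulr1 ler_pM// ?dwindow_bound// f_le1// ltW.
Qed.

Lemma dflux_bound : exists M, forall r, `|dflux r| <= M.
Proof.
have [C hC] := windowed_div_bound; exists (C * (2 * T) ^+ d.-1) => r.
have C0 : 0 <= C by apply: le_trans (hC 0); rewrite mulr_ge0 ?expR_ge0.
have C1 : 0 <= C * (2 * T) ^+ d.-1.
  by rewrite mulr_ge0// exprn_ge0// mulr_ge0// ltW.
have [rs|sr] := leP r s.
  have -> : dflux r = 0 by rewrite /dflux -/(windowed_div r) (windowed_div0 r (or_introl rs)) mul0r.
  by rewrite normr0.
have [Tr|rT] := leP (2 * T) r.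
  have -> : dflux r = 0 by rewrite /dflux -/(windowed_div r) (windowed_div0 r (or_intror Tr)) mul0r.
  by rewrite normr0.
have r0 : 0 < r by exact: lt_trans sr.
rewrite /dflux -/(windowed_div r) mulrCA mulrC normrM normrM (ger0_norm (expR_ge0 _)).
apply: ler_pM (hC r) _; rewrite ?mulr_ge0 ?expR_ge0//.
rewrite ger0_norm ?exprn_ge0 ?(ltW r0)//.
by apply: lerXn2r; rewrite ?nnegrE ?mulr_ge0 ?(ltW T0) ?(ltW r0) ?(ltW rT).
Qed.

Lemma enorm_exp (x : 'rV[R]_d) : enorm x ^+ d = enorm x * enorm x ^+ d.-1.
Proof. by rewrite -exprS prednK. Qed.

Lemma enorm_dflux (x : 'rV[R]_d) :
  enorm x * dflux (enorm x) / enorm x ^+ d = windowed_div (enorm x) * density x.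
Proof.
rewrite /dflux -/(windowed_div _) /density; have [x0|xn0] := eqVneq (enorm x) 0.
  by rewrite x0 (windowed_div0 0 (or_introl (ltW s0))) !mul0r.
rewrite enorm_exp.
transitivity (windowed_div (enorm x) * expR (v (enorm x)) *
  ((enorm x * enorm x ^+ d.-1) / (enorm x * enorm x ^+ d.-1))); first by ring.
by rewrite divff ?mulr1// mulf_neq0// expf_neq0.
Qed.

Lemma bsupp_windowed_div : bsupp (fun x : 'rV[R]_d => windowed_div (enorm x) * density x).
Proof.
split.
  under eq_fun do rewrite -enorm_dflux.
  apply: measurable_funM; last exact: measurable_enorm_exp_inv.
  apply: measurable_funM; first exact: measurable_enorm.
  apply: (@measurableT_comp _ _ _ _ _ _ dflux); last exact: measurable_enorm.
  exact: measurable_derivative is_derive_flux.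
have [C hC] := windowed_div_bound; exists C, (2 * T); split => x.
  by rewrite normrM (ger0_norm (density_ge0 x)) hC.
by move=> Tx; rewrite (windowed_div0 _ (or_intror (ltW Tx))) mul0r.
Qed.

Lemma flux_div (x : 'rV[R]_d) :
  flux (enorm x) / enorm x ^+ d = k (enorm x) * f (enorm x) * density x / enorm x.
Proof.
rewrite /flux /density; have [x0|xn0] := eqVneq (enorm x) 0.
  by rewrite x0 /k window_le ?mul0r//; exact: ltW.
rewrite enorm_exp invfM.
transitivity (k (enorm x) * f (enorm x) * expR (v (enorm x)) / enorm x *
  (enorm x ^+ d.-1 / enorm x ^+ d.-1)); first by ring.
by rewrite divff ?mulr1// expf_neq0.
Qed.

(** Integration by parts for the windowed field, with the powers of |x|
   simplified. *)
Lemma flux_identity (phi : 'rV[R]_d -> R) (h : nat -> R) :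
  measurable_fun setT phi -> (forall x, `|phi x| <= 1) ->
  (forall n, 0 < h n) -> (forall n, h n <= 1) -> h n @[n --> \oo] --> 0 ->
  volint (fun x => (phi ((1 + h n)^-1 *: x) - phi x) / h n *
     (k (enorm x) * f (enorm x) * density x / enorm x)) @[n --> \oo] -->
  volint (fun x => phi x * (windowed_div (enorm x) * density x)).
Proof.
move=> mphi phi1 h0 h1 hc; have [M hM] := dflux_bound.
have := dilation_by_parts _ _ _ _ _ phi h s0 sT2 flux_lt flux_gt is_derive_flux hM
  mphi phi1 h0 h1 hc.
under eq_fun do under eq_fun do rewrite flux_div.
by under [X in _ --> volint X -> _]eq_fun do rewrite enorm_dflux.
Qed.

Lemma bsupp_flux : bsupp (fun x : 'rV[R]_d => k (enorm x) * f (enorm x) * density x / enorm x).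
Proof.
have [M hM] := dflux_bound.
have := @bsupp_radial_weight R d _ _ _ _ _ s0 sT2 flux_lt flux_gt is_derive_flux hM.
by under eq_fun do rewrite flux_div.
Qed.

End radial_field.

(** * Lipschitz approximations of indicators and the outer flux *)

Section tents.
Context {R : realType} {d : nat}.
Variables (A : set 'rV[R]_d) (e : R).
Hypothesis e0 : 0 < e.

Let heights (x : 'rV[R]_d) : set R := [set 0] `|` [set 1 - enorm (x - a) / e | a in A].

(** This is (1 - dist(x, A) / e)^+, written as a supremum so that it is 0 for
   empty A. *)
Definition tent (x : 'rV[R]_d) : R := sup (heights x).

Let heights0 x : heights x 0. Proof. by left. Qed.

Let heights_ub x : ubound (heights x) 1.
Proof.
move=> _ [->//|[a Aa <-]]; rewrite lerBlDr lerDl divr_ge0 ?enorm_ge0//.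
exact: ltW.
Qed.

Let heights_sup x : has_sup (heights x).
Proof. by split; [exists 0|exists 1]. Qed.

Lemma tent_ge0 x : 0 <= tent x.
Proof. by apply: ub_le_sup; [case: (heights_sup x)|]. Qed.

Lemma tent_le1 x : tent x <= 1.
Proof. by apply: ge_sup; [exists 0|exact: heights_ub]. Qed.

Lemma tent_ge x a : A a -> 1 - enorm (x - a) / e <= tent x.
Proof.
by move=> Aa; apply: ub_le_sup; [case: (heights_sup x)|right; exists a].
Qed.

Lemma tent_in x : A x -> tent x = 1.
Proof.
move=> Ax; apply/eqP; rewrite eq_le tent_le1/=.
by have := tent_ge x x Ax; rewrite subrr enorm0 mul0r subr0.
Qed.

Lemma tent_out x : (forall a, A a -> e <= enorm (x - a)) -> tent x = 0.
Proof.
move=> h; apply/eqP; rewrite eq_le tent_ge0 andbT.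
apply: ge_sup; first by exists 0.
move=> _ [->//|[a Aa <-]].
by rewrite subr_le0 ler_pdivlMr// mul1r h.
Qed.

Lemma tent_lipschitz x y : `|tent x - tent y| <= enorm (x - y) / e.
Proof.
suff H u w : tent u <= tent w + enorm (u - w) / e.
  by rewrite ler_distl H andbT lerBlDr enormB H.
apply: ge_sup; first by exists 0.
move=> _ [->|[a Aa <-]].
  by rewrite addr_ge0 ?tent_ge0// divr_ge0 ?enorm_ge0// ltW.
apply: (@le_trans _ _ (1 - enorm (w - a) / e + enorm (u - w) / e)).
  have : enorm (w - a) / e <= (enorm (w - u) + enorm (u - a)) / e.
    by rewrite ler_pM2r ?invr_gt0// enorm_triangle.
  rewrite mulrDl (enormB w u); lra.
by rewrite lerD2r tent_ge.
Qed.

Lemma measurable_tent : measurable_fun setT tent.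
Proof.
apply: continuous_measurable_rV => x V /nbhs_ballP[r /= r0 rV].
apply/nbhs_enormP; exists (r * e); first exact: mulr_gt0.
move=> y yx; apply: rV; rewrite /ball/=.
by rewrite (le_lt_trans (tent_lipschitz _ _))// ltr_pdivrMr// enormB.
Qed.

(** At a point of the closure the tent equals 1, and it is 1/e-Lipschitz. *)
Lemma tent_closure x : closure A 0 -> 1 - tent x <= enorm x / e.
Proof.
move=> cA; rewrite lerBlDr -lerBlDl; apply/ler_addgt0Pr => r r0.
have [a [Aa /= ar]] : A `&` [set y | enorm (y - 0) < r * e] !=set0.
  by apply: cA; apply/nbhs_enormP; exists (r * e) => //; exact: mulr_gt0.
apply: (@le_trans _ _ (1 - enorm (x - a) / e + r)); last by rewrite lerD2r tent_ge.
rewrite subr0 in ar.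
have : enorm (x - a) / e <= (enorm x + r * e) / e.
  rewrite ler_pM2r ?invr_gt0//.
  by have := enorm_triangle 0 x a; rewrite subr0 sub0r enormN; lra.
by rewrite mulrDl mulfK ?gt_eqF//; lra.
Qed.

End tents.

Section outer_flux.
Context {R : realType} {d : nat}.
Variables (A : set 'rV[R]_d).
Hypothesis oA : open A.

Lemma sub_enlargement e : 0 < e -> A `<=` enlargement A e.
Proof. by move=> e0 x Ax; exists x => //; rewrite subrr enorm0. Qed.

Lemma open_enlargement e : open (enlargement A e).
Proof.
apply/open_enormP => x [a Aa xa]; exists (e - enorm (x - a)); first by rewrite subr_gt0.
move=> y yx; exists a => //.
by rewrite (le_lt_trans (enorm_triangle x y a))// -ltrBrDr.
Qed.

Lemma bsupp_abs (P : 'rV[R]_d -> R) : bsupp P -> bsupp (fun x => `|P x|).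
Proof.
move=> [mP [M [T [PM PT]]]]; split.
  by apply: measurableT_comp => //; exact: normr_measurable.
exists M, T; split => x; first by rewrite normr_id.
by move=> /PT ->; rewrite normr0.
Qed.

Lemma bsupp_enorm (P : 'rV[R]_d -> R) : bsupp P -> bsupp (fun x => enorm x * P x).
Proof.
move=> [mP [M [T [PM PT]]]]; split.
  by apply: measurable_funM => //; exact: measurable_enorm.
have M0 : 0 <= M by exact: le_trans (normr_ge0 _) (PM 0).
exists (`|T| * M), T; split => x; last by move=> /PT ->; rewrite mulr0.
have [xT|Tx] := leP (enorm x) T; last by rewrite PT// mulr0 normr0 mulr_ge0.
rewrite normrM ger0_norm ?enorm_ge0// ler_pM// ?enorm_ge0//.
exact: le_trans xT (ler_norm _).
Qed.

Lemma bsupp_indic (P : 'rV[R]_d -> R) E : measurable E -> bsupp P ->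
  bsupp (fun x => \1_E x * P x).
Proof.
move=> mE bP; apply: (bsuppM _ _ 1 bP); first exact/measurable_indicP.
by move=> x; rewrite indicE; case: (_ \in _); rewrite ?normr1 ?normr0.
Qed.

Lemma enorm_contraction (t : R) (x : 'rV[R]_d) : 0 < t ->
  enorm ((1 + t)^-1 *: x - x) <= t * enorm x.
Proof.
move=> t0; have l0 : 0 < 1 + t by rewrite addr_gt0.
rewrite -[X in _ - X]scale1r -scalerBl enormZ ler_wpM2r ?enorm_ge0//.
have -> : (1 + t)^-1 - 1 = - (t / (1 + t)).
  have ln : 1 + t != 0 by rewrite gt_eqF.
  by apply: (mulIf ln); rewrite mulrBl mulVf// mulNr divfK//; ring.
rewrite normrN ger0_norm; last by rewrite divr_ge0 ?(ltW t0) ?(ltW l0).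
by rewrite ler_pdivrMr// ler_peMr ?(ltW t0)// lerDl ltW.
Qed.

(** A limit of increments of the tent is paid for by the collar between A and its
   enlargement: there the Lipschitz bound applies, while elsewhere the tent is
   locally constant. The latter holds inside because A is open, and outside
   because the tent has width e' < e; with e' = e the points at distance exactly
   e would have to be shown negligible. *)
Lemma tent_flux_le (e e' : R) (P : 'rV[R]_d -> R) (h : nat -> R) (L : R) :
  0 < e' -> e' < e -> bsupp P ->
  (forall n, 0 < h n) -> h n @[n --> \oo] --> 0 ->
  volint (fun x => (tent A e' ((1 + h n)^-1 *: x) - tent A e' x) / h n * P x)
    @[n --> \oo] --> L ->
  L <= volint (fun x => \1_(enlargement A e `\` A) x * (enorm x * `|P x|)) / e'.
Proof.
move=> e'0 e'e bP h0 hc aL; pose phi := tent A e'.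
pose E := enlargement A e `\` A.
have mE : measurable E.
  apply: measurableD; last exact: open_measurable_rV.
  by apply: open_measurable_rV; exact: open_enlargement.
pose q n x : R := `|phi ((1 + h n)^-1 *: x) - phi x| / h n.
have q_ge0 n x : 0 <= q n x by rewrite divr_ge0// ltW.
have q_le n x : q n x <= enorm x / e'.
  rewrite ler_pdivrMr// (le_trans (tent_lipschitz A e' e'0 _ _))//.
  by rewrite mulrAC ler_pM2r ?invr_gt0// mulrC enorm_contraction.
have mq n : measurable_fun setT (q n).
  apply: measurable_funM => //; apply: measurableT_comp; first exact: normr_measurable.
  apply: measurable_funB; last exact: measurable_tent.
  apply: (@measurableT_comp _ _ _ _ _ _ phi); first exact: measurable_tent.
  exact: measurable_scaler.
(* The contribution of the increments outside the collar E. *)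
pose W n x := \1_(~` E) x * (q n x * `|P x|).
have b1 : bsupp (fun x => \1_E x * (enorm x * `|P x|)).
  by apply: bsupp_indic => //; apply: bsupp_enorm; exact: bsupp_abs.
have [mP [M [T [PM PT]]]] := bP.
have M0 : 0 <= M by exact: le_trans (normr_ge0 _) (PM 0).
have bW n : bounded_support (`|T| / e' * M) T (W n).
  split => x; last by move=> /PT Px; rewrite /W Px normr0 !mulr0.
  have [Tx|xT] := ltP T (enorm x).
    rewrite /W PT// normr0 !mulr0 normr0 mulr_ge0// divr_ge0//; exact: ltW.
  rewrite /W normrM -[leRHS]mul1r ler_pM//.
    by rewrite indicE; case: (_ \in _); rewrite ?normr1 ?normr0.
  rewrite normrM normr_id ler_pM// ger0_norm// (le_trans (q_le n x))//.
  by rewrite ler_pM2r ?invr_gt0// (le_trans xT)// ler_norm.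
have mW n : measurable_fun setT (W n).
  apply: measurable_funM; first by apply/measurable_indicP; exact: measurableC.
  by apply: measurable_funM => //; apply: measurableT_comp => //; exact: normr_measurable.
have Wc x : W n x @[n --> \oo] --> 0.
  have [Ex|nEx] := pselect (E x).
    apply: eq_cvg_seq (cvg_cst 0) => n.
    by rewrite /W indicE memNset ?mul0r// => /(_ Ex).
  have [dlt dlt0 hd] : exists2 dlt, 0 < dlt &
      forall y, enorm (y - x) < dlt -> phi y = phi x.
    have [Ax|nAx] := pselect (A x).
      have [dlt dlt0 hA] := (open_enormP A).1 oA _ Ax.
      by exists dlt => // y /hA Ay; rewrite /phi !tent_in.
    have xe a : A a -> e <= enorm (x - a).
      move=> Aa; rewrite leNgt; apply/negP => xa; apply: nEx; split => //.
      by exists a.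
    exists (e - e'); first by rewrite subr_gt0.
    move=> y yx; rewrite /phi !tent_out// => a Aa.
      have := xe a Aa; lra.
    have := enorm_triangle y x a; have := xe a Aa; rewrite (enormB x y); lra.
  have hx : h n * enorm x @[n --> \oo] --> 0.
    by rewrite -(mul0r (enorm x)); exact: cvgMr_tmp.
  apply: cvg_near_cst; have [N _ hN] := (cvgr0_norm_lt _ hx) _ dlt0.
  exists N => // n Nn; rewrite /= /W /q hd; first by rewrite subrr normr0 !mul0r mulr0.
  rewrite (le_lt_trans (enorm_contraction _ _ (h0 n)))//.
  by rewrite (le_lt_trans (ler_norm _))//; exact: hN.
have Wlim : volint (W n) @[n --> \oo] --> 0.
  have -> : 0 = volint ((fun=> 0) : 'rV[R]_d -> R).
    by rewrite /volint /Rintegral integral0.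
  exact: (@bounded_cvg_volint _ _ _ _ _ _ mW bW Wc).
have bWn n : bsupp (W n).
  by split; [exact: mW|exists (`|T| / e' * M), T; exact: bW].
have bound n : volint (fun x => (phi ((1 + h n)^-1 *: x) - phi x) / h n * P x) <=
    volint (fun x => \1_E x * (enorm x * `|P x|)) / e' + volint (W n).
  rewrite mulrC -volintZ// -volintD//; last exact: bsuppZ.
  apply: le_volint; [|by apply: bsuppD => //; exact: bsuppZ|].
    apply: (bsuppM _ _ (h n)^-1 bP).
      apply: measurable_funM => //; apply: measurable_funB; last exact: measurable_tent.
      apply: (@measurableT_comp _ _ _ _ _ _ phi); first exact: measurable_tent.
      exact: measurable_scaler.
    move=> x; rewrite normrM normfV (gtr0_norm (h0 n)) ler_piMl ?invr_ge0 ?(ltW (h0 n))//.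
    have := tent_ge0 A e' e'0 ((1 + h n)^-1 *: x); have := tent_ge0 A e' e'0 x.
    have := tent_le1 A e' e'0 ((1 + h n)^-1 *: x); have := tent_le1 A e' e'0 x.
    by rewrite /phi ler_norml => *; apply/andP; split; lra.
  move=> x.
  have qP : (phi ((1 + h n)^-1 *: x) - phi x) / h n * P x <= q n x * `|P x|.
    rewrite (le_trans (ler_norm _))// normrM ler_wpM2r//.
    by rewrite normrM normfV (gtr0_norm (h0 n)).
  rewrite (le_trans qP)// /W.
  have [Ex|nEx] := pselect (E x).
    rewrite !indicE mem_set// memNset; last by move=> /(_ Ex).
    by rewrite mul1r mul0r addr0 mulrA ler_wpM2r// mulrC q_le.
  rewrite !indicE memNset// mem_set//.
  by rewrite mul0r mulr0 add0r mul1r.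
have cb : volint (fun x => \1_E x * (enorm x * `|P x|)) / e' + volint (W n) @[n --> \oo] -->
    volint (fun x => \1_E x * (enorm x * `|P x|)) / e'.
  by rewrite -[X in _ --> X]addr0; apply: cvgD => //; exact: cvg_cst.
by apply: (ler_cvg_to aL cb); apply: nearW.
Qed.

End outer_flux.

(** * Measures with a radial density *)

Section radial_measures.
Context {R : realType} {d : nat}.
Variables (v : R -> R).
Hypothesis v_nd : forall r s, 0 < r -> r <= s -> v r <= v s.
Hypothesis v_der : forall r, 0 < r -> derivable v r 1.

Let rho : 'rV[R]_d -> R := density v.
Let mu := @radial_measure R d v.

Let mrho : measurable_fun setT rho. Proof. exact: measurable_density. Qed.

Let mErho D : measurable_fun D (fun x => (rho x)%:E).
Proof. by apply/measurable_EFinP; exact: measurable_funTS. Qed.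

Lemma radial_measure_ge0 A : (0 <= mu A)%E.
Proof. by apply: integral_ge0 => x _; rewrite lee_fin expR_ge0. Qed.

Lemma le_radial_measure A B : measurable A -> measurable B -> A `<=` B ->
  (mu A <= mu B)%E.
Proof.
move=> mA mB AB; by apply: ge0_subset_integral.
Qed.

Lemma radial_measureU A B : measurable A -> measurable B -> A `&` B = set0 ->
  mu (A `|` B) = (mu A + mu B)%E.
Proof.
move=> mA mB AB; apply: ge0_integral_setU => //.
by rewrite disj_set2E; apply/eqP.
Qed.

Lemma radial_measureD A B : measurable A -> measurable B -> A `<=` B ->
  mu B = (mu A + mu (B `\` A))%E.
Proof.
move=> mA mB AB; rewrite -radial_measureU ?setDUK//; first exact: measurableD.
by rewrite setDIK.
Qed.

Lemma radial_measureU_le A B : measurable A -> measurable B ->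
  (mu (A `|` B) <= mu A + mu B)%E.
Proof.
move=> mA mB; have mAB : measurable (A `|` B) by exact: measurableU.
rewrite (radial_measureD _ _ mA mAB); last by move=> x Ax; left.
apply: leeD2l; apply: le_radial_measure => //; first exact: measurableD.
by move=> x [[]].
Qed.

Definition mass_bound (T : R) : R := expR (v 0) + expR (v T).

Lemma mass_bound_ge0 T : 0 <= mass_bound T.
Proof. by rewrite addr_ge0// expR_ge0. Qed.

(** The value at the origin is bounded separately because v need not be monotone
   there. *)
Lemma density_le x T : 0 < T -> enorm x <= T -> rho x <= mass_bound T.
Proof.
move=> T0 xT; rewrite /rho /density /mass_bound.
have [x0|x0] := leP (enorm x) 0.
  have -> : enorm x = 0 by apply/eqP; rewrite eq_le x0 enorm_ge0.
  by rewrite lerDl expR_ge0.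
by rewrite (@le_trans _ _ (expR (v T)))// ?ler_expR ?v_nd// lerDr expR_ge0.
Qed.

Lemma bsupp_mass A T : 0 < T -> measurable A -> A `<=` eball d T ->
  bsupp (fun x => \1_A x * rho x).
Proof.
move=> T0 mA AT; split; first by apply: measurable_funM => //; exact/measurable_indicP.
exists (mass_bound T), T; split => x.
  rewrite indicE; have [xA|xA] := boolP (x \in A); last first.
    by rewrite mul0r normr0 mass_bound_ge0.
  rewrite mul1r ger0_norm ?expR_ge0// density_le//.
  by apply: AT; rewrite inE in xA.
move=> Tx; rewrite indicE memNset ?mul0r// => /AT.
by rewrite /eball/= leNgt Tx.
Qed.

Lemma radial_measureE A T : 0 < T -> measurable A -> A `<=` eball d T ->
  mu A = (volint (fun x => \1_A x * rho x))%:E.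
Proof.
move=> T0 mA AT; rewrite -volintE; last exact: bsupp_mass T0 mA AT.
rewrite /mu /radial_measure integral_mkcond; apply: eq_integral => x _.
by rewrite patchE indicE; case: (x \in A); rewrite ?mul1r ?mul0r.
Qed.

Lemma le_volint_radial_measure A (g : 'rV[R]_d -> R) : measurable A ->
  bsupp (fun x => \1_A x * g x) -> (forall x, 0 <= g x) -> (forall x, g x <= rho x) ->
  ((volint (fun x => \1_A x * g x))%:E <= mu A)%E.
Proof.
move=> mA bg g0 grho; rewrite -volintE//.
rewrite /mu /radial_measure [leRHS]integral_mkcond; apply: ge0_le_integral => //.
- by move=> x _; rewrite lee_fin mulr_ge0// indicE.
- by apply/measurable_EFinP; exact: bg.1.
- apply/(measurable_restrictT _ mA); exact: mErho.
move=> x _; rewrite patchE indicE; case: (x \in A); last by rewrite mul0r.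
by rewrite mul1r lee_fin grho.
Qed.

Lemma eball_exhausts A : measurable A ->
  mu (A `&` eball d n.+1%:R) @[n --> \oo] --> mu A.
Proof.
move=> mA; pose F n := A `&` eball d (n.+1%:R : R).
have -> : mu A = mu (\bigcup_n F n).
  congr mu; apply/seteqP; split => [x Ax|x [n _ []]//].
  exists (Num.truncn (enorm x)) => //; split => //.
  by rewrite /eball/= ltW// truncnS_gt.
apply: ge0_nondecreasing_set_cvg_integral.
- apply/nondecreasing_seqP => n; apply/subsetPset; apply: setIS => x.
  by rewrite /eball/= => /le_trans; apply; rewrite ler_nat.
- by move=> n; apply: measurableI => //; exact: measurable_eball.
- by move=> n; exact: mErho.
- by move=> n x _; rewrite lee_fin expR_ge0.
Qed.

End radial_measures.

(** * Comparison with the ball *)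

Section comparison.
Context {R : realType} {d : nat}.
Variables (v f : R -> R) (r0 : R).
Hypothesis d0 : (0 < d)%N.
Hypothesis r0_gt0 : 0 < r0.
Hypothesis v_nd : forall r s, 0 < r -> r <= s -> v r <= v s.
Hypothesis v_der : forall r, 0 < r -> derivable v r 1.
Hypothesis f_der : forall r : R, derivable f r 1.
Hypothesis f_le1 : forall r, 0 <= r -> `|f r| <= 1.
Hypothesis fr0 : f r0 = 1.

Let F : R -> R := @radial_div R d v f.

Hypothesis F_nd : forall r s, 0 < r -> r <= s -> F r <= F s.

Let rho : 'rV[R]_d -> R := density v.
Let mu := @radial_measure R d v.
Let B : set 'rV[R]_d := eball d r0.

(** At r0 the function f is maximal, so f' vanishes there, and v' >= 0. *)
Lemma radial_div_r0_ge0 : 0 <= F r0.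
Proof.
have df0 : f^`()%classic r0 = 0.
  have h0 : 0 <= 2 * r0 by rewrite mulr_ge0// ltW.
  have hr : r0 \in `]0, (2 * r0)[ by rewrite in_itv/= r0_gt0/=; move: r0_gt0; lra.
  have hm t : t \in `]0, (2 * r0)[ -> f t <= f r0.
    rewrite in_itv/= fr0 => /andP[t0 _].
    by rewrite (le_trans (ler_norm _))// f_le1// ltW.
  by rewrite derive1E; have [_ ->] := derive1_at_max h0 (fun t _ => f_der t) hr hm.
have dv0 : 0 <= v^`()%classic r0.
  rewrite derive1E.
  have dv : is_derive r0 1 v ('D_1 v r0) by exact: DeriveDef (v_der _ r0_gt0) _.
  have u0 n : n.+1%:R^-1 != 0 :> R by rewrite invr_eq0.
  have c := is_derive_seq _ _ _ _ dv u0 (@cvg_harmonic R).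
  apply: (cvgr_to_ge c); apply: nearW => n.
  rewrite divr_ge0 ?invr_ge0// subr_ge0 v_nd// lerDl invr_ge0//.
by rewrite /F /radial_div df0 fr0 add0r mul1r addr_ge0// divr_ge0// ltW.
Qed.

Section ball.
Variables (s T : R).
Hypotheses (s0 : 0 < s) (sr0 : 2 * s <= r0) (rT : 2 * r0 <= T).

Let W (x : 'rV[R]_d) : R := @windowed_div R d v f s T (enorm x) * rho x.

Lemma field_near_r0 eta : 0 < eta -> exists2 dlt, 0 < dlt &
  forall r, r0 < r -> r < r0 + dlt -> (1 - eta) * r <= f r * r0.
Proof.
move=> eta0.
have c : f r * r0 - (1 - eta) * r @[r --> r0] --> f r0 * r0 - (1 - eta) * r0.
  apply: cvgB; last by apply: cvgMl_tmp; exact: cvg_id.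
  by apply: cvgMr_tmp; exact: (@continuous_field _ _ f_der r0).
have l0 : 0 < f r0 * r0 - (1 - eta) * r0 by rewrite fr0 -mulrBl opprB addrCA subrr addr0 mulr_gt0.
have hn : nbhs r0 (fun r => 0 < f r * r0 - (1 - eta) * r) by exact: cvgr_gt c _ l0.
have [dlt /= dlt0 hd] := (nbhs_ballP _ _).1 hn.
exists dlt => // r r0r rd; rewrite -subr_ge0 ltW//; apply: hd.
by rewrite /ball/= distrC gtr0_norm ?subr_gt0// ltrBlDl.
Qed.

(** Integration by parts with the indicator of the ball. Its increments are
   carried by annuli just outside the sphere, where f is close to 1, so that
   they compare with the measure of the annulus divided by its width. *)
Lemma surface_ball_le :
  (surface_measure mu B <= (volint (fun x => \1_B x * W x))%:E)%E.
Proof.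
rewrite leNgt; apply/negP; rewrite /surface_measure limf_einfE => /ereal_sup_gt[_ [V V0 <-]].
set L := volint _ => LV.
have [m Lm mV] : exists2 m : R, L < m &
    forall e, V e -> (m%:E <= (mu (enlargement B e) - mu B) * (e^-1)%:E)%E.
  set g := fun e : R => ((mu (enlargement B e) - mu B) * (e^-1)%:E)%E in LV *.
  have gV e : V e -> (ereal_inf (g @` V) <= g e)%E.
    by move=> Ve; apply: ereal_inf_lbound; exists e.
  move: LV; case E : (ereal_inf (g @` V)) => [m||] // LV.
    by exists m => // e /gV; rewrite E.
  exists (L + 1); first by rewrite ltrDl.
  by move=> e /gV; rewrite E => /(le_trans _); apply; exact: leey.
pose h (n : nat) : R := n.+1%:R^-1.
have h0 n : 0 < h n by rewrite invr_gt0.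
have h1 n : h n <= 1 by rewrite invf_le1// ler1n.
have hc : h n @[n --> \oo] --> 0 by exact: cvg_harmonic.
have sT : s <= T by move: s0 sr0 rT r0_gt0; lra.
have T0 : 0 < T by move: rT r0_gt0; lra.
have mB : measurable B by exact: measurable_eball.
have mphi : measurable_fun setT (\1_B : 'rV[R]_d -> R) by exact/measurable_indicP.
have phi1 (x : 'rV[R]_d) : `|\1_B x : R| <= 1.
  by rewrite indicE; case: (_ \in _); rewrite ?normr1 ?normr0.
have := flux_identity v f d0 v_nd v_der f_der f_le1 F_nd s T s0 sT _ h mphi phi1 h0 h1 hc.
pose a n := volint (fun x => (\1_B ((1 + h n)^-1 *: x) - \1_B x) / h n *
  (window s T (enorm x) * f (enorm x) * rho x / enorm x)).
rewrite -[X in X @ _ --> _]/a -/L => aL.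
(* A nonnegative bound keeps the eta chosen below between 0 and 1. *)
pose m' := Num.max m 0.
have m'0 : 0 <= m' by rewrite le_max lexx orbT.
have Lm' : L < m' by rewrite lt_max Lm.
suff key eta : 0 < eta -> eta < 1 -> (1 - eta) * m' <= L.
  have L0 : 0 <= L.
    have h12 : 0 < 1 / 2 :> R by lra.
    have h21 : 1 / 2 < 1 :> R by lra.
    by have := key _ h12 h21; lra.
  have m'_gt0 : 0 < m' by exact: le_lt_trans Lm'.
  have e0 : 0 < (m' - L) / (2 * m') by rewrite divr_gt0 ?subr_gt0// mulr_gt0.
  have e1 : (m' - L) / (2 * m') < 1 by rewrite ltr_pdivrMr ?mulr_gt0//; lra.
  have := key _ e0 e1.
  have -> : (1 - (m' - L) / (2 * m')) * m' = (m' + L) / 2.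
    by field; rewrite gt_eqF.
  by move: Lm'; lra.
move=> eta0 eta1; apply: (cvgr_to_ge aL).
have [dlt dlt0 hd] := field_near_r0 _ eta0.
have [e /= e0 hV] : exists2 e, 0 < e & forall x, 0 < x -> x < e -> V x.
  move: V0 => [e /= e0 hV]; exists e => // x x0 xe; apply: hV => //.
  by rewrite /ball/= sub0r normrN gtr0_norm.
have hr0 : r0 * h n @[n --> \oo] --> 0.
  by rewrite -(mulr0 r0); exact: cvgMl_tmp.
have md0 : 0 < Num.min (Num.min dlt e) r0 by rewrite !lt_min dlt0 e0.
have [N _ hN] := cvgr0_norm_lt _ hr0 _ md0.
exists N => // n /hN /=; rewrite gtr0_norm ?mulr_gt0// !lt_min => /andP[/andP[hd' he] hr].
set eps := r0 * h n in hd' he hr.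
have eps0 : 0 < eps by exact: mulr_gt0.
have lamE : (1 + h n) * r0 = r0 + eps by rewrite mulrDl mul1r mulrC.
pose Ann := eball d (r0 + eps) `\` B.
have mAnn : measurable Ann by apply: measurableD => //; exact: measurable_eball.
have AnnS : Ann `<=` eball d (r0 + eps) by move=> x [].
have re0 : 0 < r0 + eps by exact: addr_gt0.
have muAnn := radial_measureE v v_nd v_der Ann _ re0 mAnn AnnS.
have bAnn := bsupp_mass v v_nd v_der Ann _ re0 mAnn AnnS.
set MA := volint _ in muAnn.
have mMA : m' * eps <= MA.
  have MA0 : 0 <= MA.
    by rewrite -lee_fin -muAnn radial_measure_ge0.
  rewrite /m'; have [m0|m0] := leP m 0; first by rewrite mul0r.
  rewrite -ler_pdivlMr// -lee_fin (le_trans (mV _ (hV _ eps0 he)))// EFinM.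
  apply: lee_wpmul2r; first by rewrite lee_fin invr_ge0 ltW.
  have muB : mu B \is a fin_num.
    by rewrite /mu (radial_measureE v v_nd v_der B r0).
  rewrite leeBlDl// -muAnn /mu -radial_measureD//; last 2 first.
  - exact: measurable_eball.
  - by move=> x; rewrite /B /eball/= => /le_trans; apply; rewrite lerDl ltW.
  apply: le_radial_measure => //.
  - by apply: open_measurable_rV; exact: open_enlargement.
  - exact: measurable_eball.
  move=> x [y By xy]; rewrite /eball/= -(subrK y x) (le_trans (enormD _ _))//.
  by rewrite addrC lerD// ltW.
(* Pointwise, the increment of the indicator is at least the indicator of the
   annulus, weighted by (1 - eta) / eps. *)
rewrite (@le_trans _ _ ((1 - eta) / eps * MA))//.
  by rewrite mulrAC ler_pdivlMr// -mulrA ler_wpM2l// subr_ge0 ltW.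
have bP := bsupp_flux v f d0 v_nd v_der f_der f_le1 F_nd s T s0 sT.
have ln0 : 0 < 1 + h n by rewrite addr_gt0.
have B_dil x : B ((1 + h n)^-1 *: x) = (enorm x <= r0 + eps).
  rewrite /B /eball/= enormZ gtr0_norm ?invr_gt0// mulrC ler_pdivrMr//.
  by rewrite mulrC lamE.
rewrite -volintZ//; apply: le_volint; first exact: bsuppZ.
  apply: (bsuppM _ _ (h n)^-1 bP).
    apply: measurable_funM => //; apply: measurable_funB => //.
    apply: (@measurableT_comp _ _ _ _ _ _ (\1_B : 'rV[R]_d -> R)) => //.
    exact: measurable_scaler.
  move=> x; rewrite normrM normfV (gtr0_norm (h0 n)) ler_piMl ?invr_ge0 ?(ltW (h0 n))//.
  by rewrite !indicE; case: (_ \in _); case: (_ \in _);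
    rewrite ?subrr ?subr0 ?sub0r ?normrN ?normr1 ?normr0.
move=> x; rewrite !indicE.
have [xr|rx] := leP (enorm x) r0.
  have xB : x \in B by rewrite inE.
  rewrite xB memNset; last by move=> -[_]; apply.
  rewrite mem_set; last by rewrite B_dil (le_trans xr)// lerDl ltW.
  by rewrite subrr !mul0r mulr0.
have xB : (x \in B) = false by rewrite memNset// /B /eball/= leNgt rx.
rewrite xB subr0; have [xe|ex] := leP (enorm x) (r0 + eps); last first.
  rewrite memNset; last by move=> -[]; rewrite /eball/= leNgt ex.
  rewrite memNset; last by rewrite B_dil leNgt ex.
  by rewrite mul0r mulr0 !mul0r.
rewrite mem_set; last by split => //; rewrite /B /eball/= leNgt rx.
rewrite mem_set ?B_dil// !mul1r.
have x0 : 0 < enorm x by exact: lt_trans rx.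
rewrite /window rise_ge//; last by rewrite (le_trans sr0)// ltW.
rewrite fall_le//; last by move: rT hr xe; lra.
rewrite !mul1r.
have := hd _ rx (le_lt_trans xe _); rewrite ltrD2l => /(_ hd') hf.
have -> : (h n)^-1 * (f (enorm x) * rho x / enorm x) =
    (f (enorm x) * r0) / (enorm x * eps) * rho x.
  by rewrite /eps; field; rewrite !gt_eqF.
rewrite ler_wpM2r ?expR_ge0// ler_pdivrMr// mulrC.
rewrite mulrA -mulrA.
have -> : eps * (f (enorm x) * r0 / (enorm x * eps)) = f (enorm x) * r0 / enorm x.
  by field; rewrite !gt_eqF.
by rewrite ler_pdivlMr.
Qed.

Section competitor.
Variables (A : set 'rV[R]_d) (e e' sg : R).
Hypotheses (oA : open A) (e'0 : 0 < e') (e'e : e' < e) (sg0 : 0 <= sg).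

Let phi := tent A e'.

Hypothesis hsg : forall x, enorm x <= 2 * s -> (1 - phi x) * f (enorm x) <= sg.

Let c := F r0.
Let M0 := mass_bound v r0.
Let AT := A `&` eball d T.
Let Ae := enlargement A e `&` eball d (2 * T).

Let phi_ge0 x : 0 <= phi x. Proof. exact: tent_ge0. Qed.
Let phi_le1 x : phi x <= 1. Proof. exact: tent_le1. Qed.

(** The integrand of the comparison between A and the ball. The divergence is at
   most c = F r0 inside the ball and at least c outside, while phi - 1_B is
   nonpositive inside and nonnegative outside; replacing F by c can therefore
   only decrease the right-hand side. The other terms account for the two ends
   of the window. *)
Lemma pointwise_compare x :
  c * (\1_AT x * rho x - \1_B x * rho x)
  - ((c + 4 / s * sg) * M0 * \1_(eball d (2 * s)) x) - 4 / T * (\1_Ae x * rho x)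
  <= phi x * W x - \1_B x * W x.
Proof.
have c0 : 0 <= c := radial_div_r0_ge0.
have T0 : 0 < T by move: rT r0_gt0; lra.
have rho0 : 0 <= rho x by exact: expR_ge0.
have Ae0 : 0 <= 4 / T * (\1_Ae x * rho x).
  by rewrite mulr_ge0 ?divr_ge0 ?(ltW T0)// mulr_ge0// indicE.
have AT_le1 : \1_AT x <= 1 :> R by rewrite indicE; case: (_ \in _).
have AT_phi : \1_AT x <= phi x.
  rewrite indicE; have [|_] := boolP (x \in AT); last exact: phi_ge0.
  by rewrite inE => -[Ax _]; rewrite /phi tent_in.
have [xr|rx] := leP (enorm x) r0.
  have -> : \1_B x = 1 :> R by rewrite indicE mem_set.
  have xT : enorm x <= T by rewrite (le_trans xr)//; move: rT r0_gt0; lra.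
  have WE : W x = (rise s (enorm x) * F (enorm x) + drise s (enorm x) * f (enorm x)) * rho x.
    by rewrite /W /windowed_div /window /dwindow fall_le// dfall_le// !mulr0 addr0 !mulr1.
  have ri0 : 0 <= rise s (enorm x) by exact: cutoff_ge0.
  have ri1 : rise s (enorm x) <= 1 by exact: cutoff_le1.
  have dri0 := @drise_ge0 R s (enorm x) s0.
  have dri1 := @drise_bound R s (enorm x) s0.
  have riF : rise s (enorm x) * F (enorm x) <= rise s (enorm x) * c.
    have [xs|sx] := leP (enorm x) s; first by rewrite rise_le// !mul0r.
    by rewrite ler_wpM2l// F_nd// (lt_trans s0).
  have p0 := phi_ge0 x; have p1 := phi_le1 x.
  have [xs|sx] := leP (enorm x) (2 * s).
    have -> : \1_(eball d (2 * s)) x = 1 :> R by rewrite indicE mem_set.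
    have rM : rho x <= M0 by apply: density_le.
    have h1 : (1 - phi x) * (rise s (enorm x) * F (enorm x)) <= c.
      rewrite (@le_trans _ _ (1 * (1 * c)))//; last by rewrite !mul1r.
      rewrite (@le_trans _ _ ((1 - phi x) * (rise s (enorm x) * c)))//.
        by rewrite ler_wpM2l// subr_ge0.
      by apply: ler_pM;
        [rewrite subr_ge0|rewrite mulr_ge0|rewrite lerBlDr lerDl|rewrite ler_wpM2r].
    have h2 : (1 - phi x) * f (enorm x) * drise s (enorm x) <= 4 / s * sg.
      rewrite (@le_trans _ _ (sg * drise s (enorm x)))//; first by rewrite ler_wpM2r// hsg.
      by rewrite mulrC ler_wpM2r.
    have h3 : (c + 4 / s * sg) * rho x <= (c + 4 / s * sg) * M0.
      by rewrite ler_wpM2l// addr_ge0// mulr_ge0// divr_ge0// ltW.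
    have h4 : ((1 - phi x) * (rise s (enorm x) * F (enorm x)) +
       (1 - phi x) * f (enorm x) * drise s (enorm x)) * rho x <= (c + 4 / s * sg) * rho x.
      by rewrite ler_wpM2r// lerD.
    have h5 : c * (\1_AT x * rho x - 1 * rho x) <= 0.
      by rewrite -mulrBl mulr_ge0_le0// mulr_le0_ge0// subr_le0.
    rewrite WE mulr1.
    apply: (@le_trans _ _ (- ((c + 4 / s * sg) * rho x))); first by move: Ae0 h5 h3; lra.
    rewrite lerNl (le_trans _ h4)//.
    by rewrite le_eqVlt; apply/orP; left; apply/eqP; ring.
  have -> : \1_(eball d (2 * s)) x = 0 :> R.
    by rewrite indicE memNset// /eball/= leNgt sx.
  rewrite mulr0 subr0 WE rise_ge ?(ltW sx)// drise_ge ?(ltW sx)// mul0r addr0 mul1r.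
  rewrite rise_ge ?(ltW sx)// !mul1r in riF.
  have h : c * (\1_AT x * rho x - 1 * rho x) <=
      phi x * (F (enorm x) * rho x) - 1 * (F (enorm x) * rho x).
    rewrite -!mulrBl !mulrA ler_wpM2r// -subr_ge0.
    have -> : (phi x - 1) * F (enorm x) - c * (\1_AT x - 1) =
      (1 - phi x) * (c - F (enorm x)) + c * (phi x - \1_AT x) by ring.
    by rewrite addr_ge0// mulr_ge0// ?subr_ge0.
  by move: Ae0 h; lra.
have -> : \1_B x = 0 :> R by rewrite indicE memNset// /B /eball/= leNgt rx.
have sx : 2 * s <= enorm x by rewrite (le_trans sr0)// ltW.
have x0 : 0 < enorm x by exact: lt_trans rx.
rewrite !mul0r !subr0.
have B2s : 0 <= (c + 4 / s * sg) * M0 * \1_(eball d (2 * s)) x.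
  rewrite mulr_ge0// ?indicE// mulr_ge0 ?mass_bound_ge0// addr_ge0//.
  by rewrite mulr_ge0// divr_ge0// ltW.
have WE : W x = (fall T (enorm x) * F (enorm x) + dfall T (enorm x) * f (enorm x)) * rho x.
  by rewrite /W /windowed_div /window /dwindow rise_ge// drise_ge// !mul1r mul0r add0r.
have fa0 : 0 <= fall T (enorm x) by exact: cutoff_ge0.
have cF : c <= F (enorm x) by apply: F_nd => //; exact: ltW.
have h1 : c * \1_AT x <= phi x * fall T (enorm x) * F (enorm x).
  rewrite indicE; have [|_] := boolP (x \in AT); last first.
    by rewrite mulr0; apply: mulr_ge0; [rewrite mulr_ge0|exact: le_trans cF].
  rewrite inE => -[Ax xT]; rewrite /phi tent_in// fall_le// !mul1r mulr1//.
have h2 : - (4 / T * \1_Ae x) <= phi x * (dfall T (enorm x) * f (enorm x)).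
  rewrite indicE; have [_|] := boolP (x \in Ae).
    rewrite mulr1 lerNl (le_trans (ler_norm _))// normrN normrM (normrM (dfall T _)).
    rewrite -[leRHS]mul1r; apply: ler_pM; rewrite ?mulr_ge0 ?(ger0_norm (phi_ge0 x))//.
    rewrite -[leRHS]mulr1; apply: ler_pM => //; last by rewrite f_le1 ?enorm_ge0.
    by rewrite (ler0_norm (dfall_le0 _ _ T0)) lerNl dfall_bound.
  rewrite notin_setE mulr0 oppr0 => /not_andP[xA|xT].
    rewrite /phi tent_out ?mul0r// => a Aa.
    rewrite leNgt; apply/negP => xa; apply: xA; exists a => //.
    exact: lt_trans e'e.
  rewrite dfall_ge ?mul0r ?mulr0//.
  by move: xT; rewrite /eball/= => /negP; rewrite -ltNge => /ltW.
have h3 : (c * \1_AT x - 4 / T * \1_Ae x) * rho x <=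
   (phi x * fall T (enorm x) * F (enorm x) + phi x * (dfall T (enorm x) * f (enorm x))) * rho x.
  by rewrite ler_wpM2r// lerD.
rewrite WE; apply: (le_trans (le_trans _ h3)); first by move: B2s; lra.
by rewrite le_eqVlt; apply/orP; left; apply/eqP; ring.
Qed.

Definition ball_volume (t : R) : R := volint (fun x : 'rV[R]_d => \1_(eball d t) x).

Lemma bsupp_ball (t : R) : bsupp (fun x : 'rV[R]_d => \1_(eball d t) x : R).
Proof.
split; first by apply/measurable_indicP; exact: measurable_eball.
exists 1, t; split => x; rewrite indicE.
  by case: (_ \in _); rewrite ?normr1 ?normr0.
by move=> tx; rewrite memNset// /eball/= leNgt tx.
Qed.

Lemma ball_volume_scale (t : R) : 0 < t -> ball_volume t = t ^+ d * ball_volume 1.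
Proof.
move=> t0; have := volint_dilation _ _ t0 (bsupp_ball t).
have -> : (fun x : 'rV[R]_d => \1_(eball d t) (t *: x) : R) = \1_(eball d 1).
  apply/funext => x; rewrite !indicE; congr (nat_of_bool _)%:R.
  have E : (enorm (t *: x) <= t) = (enorm x <= 1).
    by rewrite enormZ gtr0_norm// -{2}(mulr1 t) ler_pM2l.
  by apply/idP/idP; rewrite !inE /eball/= E.
rewrite -/(ball_volume 1) -/(ball_volume t) => ->.
by rewrite mulrA -exprMn divff ?expr1n ?mul1r// gt_eqF.
Qed.

(** Integrate the pointwise comparison, and bound the flux through the collar of
   A by the measure of the collar. *)
Lemma surface_compare : (mu (enlargement A e) < +oo)%E ->
  (surface_measure mu B <=
   (fine (mu (enlargement A e `\` A)) / e' + c * (fine (mu B) - fine (mu AT))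
    + (c + 4 / s * sg) * M0 * ((2 * s) ^+ d * ball_volume 1)
    + 4 / T * fine (mu (enlargement A e)))%:E)%E.
Proof.
move=> Afin; apply: (le_trans surface_ball_le); rewrite lee_fin.
have sT : s <= T by move: s0 sr0 rT r0_gt0; lra.
have T0 : 0 < T by move: rT r0_gt0; lra.
have e0 : 0 < e by exact: lt_trans e'e.
have mA : measurable A by exact: open_measurable_rV.
have mAe : measurable (enlargement A e).
  by apply: open_measurable_rV; exact: open_enlargement.
have mE : measurable (enlargement A e `\` A) by exact: measurableD.
have fin S : measurable S -> S `<=` enlargement A e -> mu S \is a fin_num.
  move=> mS SA; rewrite ge0_fin_numE; last exact: radial_measure_ge0.
  by apply: le_lt_trans Afin; exact: le_radial_measure.
have mbT (t : R) : measurable (eball d t) by exact: measurable_eball.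
have bAT : bsupp (fun x => \1_AT x * rho x).
  by apply: (bsupp_mass _ v_nd v_der AT T T0); [exact: measurableI|move=> x []].
have T20 : 0 < 2 * T by rewrite mulr_gt0.
have bAe : bsupp (fun x => \1_Ae x * rho x).
  by apply: (bsupp_mass _ v_nd v_der Ae (2 * T) T20); [exact: measurableI|move=> x []].
have bB : bsupp (fun x => \1_B x * rho x).
  by apply: (bsupp_mass _ v_nd v_der B r0 r0_gt0) => //; exact: mbT.
have bW : bsupp W := bsupp_windowed_div v f d0 v_nd v_der f_der f_le1 F_nd s T s0 sT.
have mphi : measurable_fun setT phi by exact: measurable_tent.
have phi1 x : `|phi x| <= 1 by rewrite ger0_norm.
have bphiW : bsupp (fun x => phi x * W x) by exact: (bsuppM _ _ 1 bW).
have bBW : bsupp (fun x => \1_B x * W x) by apply: bsupp_indic => //; exact: mbT.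
have bvol := bsupp_ball (2 * s).
have cmp : c * (fine (mu AT) - fine (mu B))
  - (c + 4 / s * sg) * M0 * ball_volume (2 * s) - 4 / T * fine (mu (enlargement A e))
  <= volint (fun x => phi x * W x) - volint (fun x => \1_B x * W x).
  have h1 : fine (mu AT) = volint (fun x => \1_AT x * rho x).
    by rewrite /mu (radial_measureE v v_nd v_der AT T)//; [exact: measurableI|move=> x []].
  have h2 : fine (mu B) = volint (fun x => \1_B x * rho x).
    by rewrite /mu (radial_measureE v v_nd v_der B r0)//; exact: mbT.
  have h3 : volint (fun x => \1_Ae x * rho x) <= fine (mu (enlargement A e)).
    have muAe : mu Ae = (volint (fun x => \1_Ae x * rho x))%:E.
      by apply: (radial_measureE v v_nd v_der Ae (2 * T) T20); [exact: measurableI|move=> x []].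
    apply: (@le_trans _ _ (fine (mu Ae))); first by rewrite muAe.
    apply: fine_le; [|by apply: fin|].
      by apply: fin; [exact: measurableI|move=> x []].
    by apply: le_radial_measure => //; [exact: measurableI|move=> x []].
  have bg1 := bsuppZ _ c (bsuppB _ _ bAT bB).
  have bg2 := bsuppZ _ ((c + 4 / s * sg) * M0) bvol.
  have bg3 := bsuppZ _ (4 / T) bAe.
  rewrite h1 h2 -!volintB//.
  apply: (@le_trans _ _ (volint (fun x => c * (\1_AT x * rho x - \1_B x * rho x)
    - ((c + 4 / s * sg) * M0 * \1_(eball d (2 * s)) x) - 4 / T * (\1_Ae x * rho x)))).
    rewrite (volintB _ _ (bsuppB _ _ bg1 bg2) bg3) (volintB _ _ bg1 bg2).
    rewrite (volintZ _ _ (bsuppB _ _ bAT bB)) (volintZ _ _ bvol) (volintZ _ _ bAe).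
    by rewrite lerD2l lerN2 ler_wpM2l// divr_ge0// ltW.
  apply: le_volint; [|exact: bsuppB|exact: pointwise_compare].
  by apply: bsuppB => //; exact: bsuppB.
pose h (n : nat) : R := n.+1%:R^-1.
have h0 n : 0 < h n by rewrite invr_gt0.
have h1 n : h n <= 1 by rewrite invf_le1// ler1n.
have hc : h n @[n --> \oo] --> 0 by exact: cvg_harmonic.
have bP := bsupp_flux v f d0 v_nd v_der f_der f_le1 F_nd s T s0 sT.
have lim := flux_identity v f d0 v_nd v_der f_der f_le1 F_nd s T s0 sT phi h mphi phi1 h0 h1 hc.
have out := tent_flux_le A oA e e' _ h _ e'0 e'e bP h0 hc lim.
have le_rho x : enorm x * `|window s T (enorm x) * f (enorm x) * rho x / enorm x| <= rho x.
  have [x0|xn0] := eqVneq (enorm x) 0; first by rewrite x0 mul0r expR_ge0.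
  have xgt0 : 0 < enorm x by rewrite lt_def xn0 enorm_ge0.
  rewrite normrM normfV (gtr0_norm xgt0) mulrCA divff// mulr1.
  rewrite normrM (ger0_norm (expR_ge0 _)) ler_piMl ?expR_ge0// normrM.
  apply: mulr_ile1 => //; last by rewrite f_le1// ltW.
  by rewrite ger0_norm ?window_ge0 ?window_le1.
have outE : volint (fun x => \1_(enlargement A e `\` A) x *
   (enorm x * `|window s T (enorm x) * f (enorm x) * rho x / enorm x|))
   <= fine (mu (enlargement A e `\` A)).
  have finE : mu (enlargement A e `\` A) \is a fin_num by apply: fin => // x [].
  rewrite -lee_fin (fineK finE).
  have bg := bsupp_indic _ _ mE (bsupp_enorm _ (bsupp_abs _ bP)).
  apply: (le_volint_radial_measure v v_der _ _ mE bg) => //.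
  by move=> x; rewrite mulr_ge0// enorm_ge0.
have out2 : volint (fun x => phi x * W x) <= fine (mu (enlargement A e `\` A)) / e'.
  by apply: (le_trans out); rewrite ler_pM2r ?invr_gt0.
rewrite ball_volume_scale in cmp; last by rewrite mulr_gt0.
move: cmp out2; lra.
Qed.

End competitor.

End ball.

(** The field f(|x|) x / |x| is singular at the origin. In dimension at least 2
   small spheres carry no flux; in dimension 1 the origin is a source of strength
   proportional to f 0, and it lies in the ball. The comparison survives if it
   lies in the closure of A too, or if this strength is not positive. *)
Definition harmless_origin (A : set 'rV[R]_d) : Prop :=
  [\/ (2 <= d)%N, closure A 0 | f 0 <= 0].

(** The flux lost near the origin is at most a constant times sg s^(d-1): in high
   dimension the power is small, otherwise sg is. *)
Lemma origin_defect_small (A : set 'rV[R]_d) (e' theta : R) : 0 < e' -> 0 < theta ->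
  harmless_origin A -> exists2 dlt, 0 < dlt & forall s, 0 < s -> s <= dlt ->
    exists sg, [/\ 0 <= sg,
      forall x, enorm x <= 2 * s -> (1 - tent A e' x) * f (enorm x) <= sg &
      sg * s ^+ d.-1 <= theta].
Proof.
move=> e'0 th0 harmless.
have p0 x : 0 <= 1 - tent A e' x by rewrite subr_ge0 tent_le1.
have p1 x : 1 - tent A e' x <= 1 by rewrite lerBlDr lerDl tent_ge0.
have fle (x : 'rV[R]_d) : f (enorm x) <= 1.
  by rewrite (le_trans (ler_norm _))// f_le1// enorm_ge0.
have sle1 (s : R) : 0 < s -> s <= 1 -> s ^+ d.-1 <= 1.
  by move=> s0 s1; rewrite exprn_ile1// ltW.
case: harmless => [d2|cA|f0].
- exists (Num.min 1 theta); first by rewrite lt_min ltr01.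
  move=> s s0; rewrite le_min => /andP[s1 sth]; exists 1; split => //.
    move=> x _; have [fx|fx] := leP 0 (f (enorm x)); first exact: mulr_ile1.
    by rewrite (@le_trans _ _ 0)// mulr_ge0_le0// ltW.
  rewrite mul1r (le_trans _ sth)//.
  have -> : d.-1 = d.-2.+1 by case: (d) d2 => [//|[]].
  by rewrite exprS ler_piMr ?(ltW s0)// exprn_ile1// ltW.
- exists (Num.min 1 (theta * e' / 2)); first by rewrite lt_min ltr01 divr_gt0// mulr_gt0.
  move=> s s0; rewrite le_min => /andP[s1 sth]; exists (2 * s / e'); split.
  + by rewrite divr_ge0 ?(ltW e'0)// mulr_ge0// ltW.
  + move=> x xs; rewrite (@le_trans _ _ (1 - tent A e' x))// ?ler_piMr//.
    rewrite (le_trans (tent_closure A e' e'0 x cA))//.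
    by rewrite ler_pM2r ?invr_gt0.
  have h : 2 * s / e' <= theta by rewrite ler_pdivrMr//; lra.
  rewrite (le_trans _ h)// ler_piMr ?sle1//.
  by rewrite divr_ge0 ?(ltW e'0)// mulr_ge0// ltW.
have hn : nbhs (0 : R) (fun r => f r < theta).
  by apply: (cvgr_lt _ (@continuous_field _ _ f_der 0)); exact: le_lt_trans f0 th0.
have [dlt /= dlt0 hd] := (nbhs_ballP _ _).1 hn.
exists (Num.min 1 (dlt / 4)); first by rewrite lt_min ltr01 divr_gt0.
move=> s s0; rewrite le_min => /andP[s1 sth]; exists theta; split; first exact: ltW.
  move=> x xs; have fx : f (enorm x) <= theta.
    apply/ltW/hd; rewrite /ball/= sub0r normrN ger0_norm ?enorm_ge0//.
    by move: xs sth dlt0; lra.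
  have [f0x|f0x] := leP 0 (f (enorm x)).
    by rewrite (le_trans _ fx)// ler_piMl.
  by rewrite (@le_trans _ _ 0) ?(ltW th0)// mulr_ge0_le0// ltW.
by rewrite ler_piMr ?sle1// ltW.
Qed.

Section quotient.
Variables (A : set 'rV[R]_d) (e : R).
Hypotheses (oA : open A) (e_gt0 : 0 < e).
Hypothesis muA : mu A \is a fin_num.
Hypothesis muBA : (mu B <= mu A)%E.
Hypothesis harmless : harmless_origin A.

(** Let the lower end s of the window go to 0, then its upper end to infinity. *)
Lemma surface_le_tent (e' : R) : 0 < e' -> e' < e -> (mu (enlargement A e) < +oo)%E ->
  (surface_measure mu B <= (fine (mu (enlargement A e `\` A)) / e')%:E)%E.
Proof.
move=> e'0 e'e Afin; apply/lee_addgt0Pr => eta eta0.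
pose c := F r0; have c0 : 0 <= c := radial_div_r0_ge0.
pose V1 : R := ball_volume 1.
have V1_ge0 : 0 <= V1 by apply: Rintegral_ge0 => x _; rewrite indicE.
(* The error at the lower end of the window is K (c s^d + 4 sg s^(d-1)); each of
   the four error terms is made at most eta / 4. *)
pose K := mass_bound v r0 * 2 ^+ d * V1.
have K0 : 0 <= K by rewrite !mulr_ge0// mass_bound_ge0.
have th0 : 0 < eta / (16 * (K + 1)) by rewrite divr_gt0// mulr_gt0//; move: K0; lra.
have [dlt dlt0 hd] := origin_defect_small A _ _ e'0 th0 harmless.
have Kc0 : 0 <= K * c by exact: mulr_ge0.
pose s := Num.min (Num.min dlt (r0 / 2)) (Num.min 1 (eta / (4 * (K * c + 1)))).
have s0 : 0 < s.
  rewrite !lt_min dlt0 ltr01 !divr_gt0//= mulr_gt0//; move: Kc0; lra.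
have [sd sr s1 sK] : [/\ s <= dlt, s <= r0 / 2, s <= 1 & s <= eta / (4 * (K * c + 1))].
  by split; rewrite /s !ge_min lexx ?orbT.
have [sg [sg0 hsg sgs]] := hd s s0 sd.
have sr0 : 2 * s <= r0 by move: sr; lra.
have err1 : (c + 4 / s * sg) * mass_bound v r0 * ((2 * s) ^+ d * V1) <= eta / 2.
  have sd1 : s ^+ d = s * s ^+ d.-1 by rewrite -exprS prednK.
  have -> : (c + 4 / s * sg) * mass_bound v r0 * ((2 * s) ^+ d * V1) =
     K * c * s ^+ d + 4 * K * (sg * s ^+ d.-1).
    rewrite exprMn sd1 /K.
    transitivity (mass_bound v r0 * 2 ^+ d * V1 * c * (s * s ^+ d.-1) +
      4 * (mass_bound v r0 * 2 ^+ d * V1) * (sg * s ^+ d.-1) * (s / s)); first by ring.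
    by rewrite divff ?mulr1// gt_eqF.
  have sds : s ^+ d <= s.
    by rewrite sd1 ler_piMr ?(ltW s0)// exprn_ile1// ltW.
  have b1 : K * c * s ^+ d <= eta / 4.
    have Kp : 0 < 4 * (K * c + 1) by move: Kc0; lra.
    have : s * (4 * (K * c + 1)) <= eta by rewrite -ler_pdivlMr.
    have := ler_wpM2l Kc0 sds; lra.
  have b2 : 4 * K * (sg * s ^+ d.-1) <= eta / 4.
    have Kp : 0 < 16 * (K + 1) by move: K0; lra.
    have : sg * s ^+ d.-1 * (16 * (K + 1)) <= eta by rewrite -ler_pdivlMr.
    have sp : 0 <= s ^+ d.-1 by apply: exprn_ge0; exact: ltW.
    have q1 : 0 <= sg * s ^+ d.-1 by exact: mulr_ge0.
    have q2 : 0 <= sg * s ^+ d.-1 * K by exact: mulr_ge0.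
    move: q1 q2; lra.
  move: b1 b2; lra.
have mA : measurable A by exact: open_measurable_rV.
pose an (n : nat) : R := c * (fine (mu B) - fine (mu (A `&` eball d n.+1%:R))).
have an_cvg : an n @[n --> \oo] --> c * (fine (mu B) - fine (mu A)).
  apply: cvgMl_tmp; apply: cvgB; first exact: cvg_cst.
  apply: fine_cvg; rewrite fineK//; exact: eball_exhausts.
have an_lim : c * (fine (mu B) - fine (mu A)) < eta / 4.
  apply: (@le_lt_trans _ _ 0); last by rewrite divr_gt0.
  rewrite mulr_ge0_le0// subr_le0 fine_le//.
  by rewrite /mu (radial_measureE v v_nd v_der B r0)//; exact: measurable_eball.
pose bn (n : nat) : R := 4 * fine (mu (enlargement A e)) * n.+1%:R^-1.
have bn_cvg : bn n @[n --> \oo] --> 0.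
  by rewrite -(mulr0 (4 * fine (mu (enlargement A e)))); apply: cvgMl_tmp; exact: cvg_harmonic.
have eta4 : 0 < eta / 4 by rewrite divr_gt0.
have [N1 _ h1] := cvgr_lt _ an_cvg _ an_lim.
have [N2 _ h2] := cvgr_lt _ bn_cvg _ eta4.
pose n := maxn (maxn N1 N2) (Num.truncn (2 * r0)).
have n1 : an n < eta / 4 by apply: h1; rewrite /= /n !leq_max leqnn.
have n2 : bn n < eta / 4 by apply: h2; rewrite /= /n !leq_max leqnn orbT.
have rT : 2 * r0 <= n.+1%:R.
  rewrite (le_trans (ltW (truncnS_gt _)))// ler_nat ltnS.
  by rewrite /n leq_max leqnn orbT.
apply: (le_trans (surface_compare s _ s0 sr0 rT A e e' sg oA e'0 e'e sg0 hsg Afin)).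
rewrite -EFinD lee_fin.
have -> : 4 / n.+1%:R * fine (mu (enlargement A e)) = bn n by rewrite /bn; ring.
rewrite -/(an n) -/V1 -/c; move: err1 n1 n2; lra.
Qed.

(** Let the width of the tent increase to e; if the enlargement has infinite
   measure there is nothing to prove. *)
Lemma surface_le_quotient :
  (surface_measure mu B <= (mu (enlargement A e) - mu A) * (e^-1)%:E)%E.
Proof.
have mA : measurable A by exact: open_measurable_rV.
have mAe : measurable (enlargement A e).
  by apply: open_measurable_rV; exact: open_enlargement.
have [Ainf|Afin] := eqVneq (mu (enlargement A e)) +oo%E.
  rewrite Ainf -(fineK muA) -EFinN addye//.
  by rewrite gt0_mulye ?leey// lte_fin invr_gt0.
have {}Afin : (mu (enlargement A e) < +oo)%E by rewrite ltey.
have AAe := sub_enlargement A e e_gt0.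
have muE := radial_measureD v v_der _ _ mA mAe AAe.
set E := enlargement A e `\` A in muE.
have mE : measurable E by exact: measurableD.
have finE : mu E \is a fin_num.
  rewrite ge0_fin_numE; last exact: radial_measure_ge0.
  by apply: le_lt_trans Afin; apply: le_radial_measure => // x [].
have -> : (mu (enlargement A e) - mu A = mu E)%E.
  by rewrite /mu muE addeAC subee ?add0e.
have X0 : 0 <= fine (mu E) by rewrite fine_ge0// radial_measure_ge0.
rewrite -(fineK finE) -EFinM.
have [h1 h2] : 0 < e / 2 /\ e / 2 < e by split; move: e_gt0; lra.
have key e' (p : 0 < e') (q : e' < e) := surface_le_tent e' p q Afin.
have := key _ h1 h2.
case: (surface_measure mu B) key => [y key _|//|_ _]; last exact: leNye.
rewrite lee_fin leNgt; apply/negP; rewrite ltr_pdivrMr// => Xy.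
have y0 : 0 < y by rewrite -(pmulr_lgt0 _ e_gt0) (le_lt_trans X0).
have q : fine (mu E) / y < e by rewrite ltr_pdivrMr// mulrC.
have q0 : 0 <= fine (mu E) / y by rewrite divr_ge0// ltW.
have e1 : 0 < (fine (mu E) / y + e) / 2 by move: e_gt0; lra.
have e2 : (fine (mu E) / y + e) / 2 < e by move: e_gt0; lra.
have := key _ e1 e2; rewrite lee_fin ler_pdivlMr//.
rewrite mulrC -ler_pdivlMr//; lra.
Qed.

End quotient.

End comparison.

(** * Sets on the line that stay away from the origin *)

Section constant_bounds.
Context {R : realType} {d : nat}.
Variables (v : R -> R).
Hypothesis v_der : forall r, 0 < r -> derivable v r 1.

Lemma radial_measure_ge_cst (S : set 'rV[R]_d) (m : R) : measurable S -> 0 <= m ->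
  (forall x, S x -> m <= density v x) ->
  (m%:E * lebesgue_rV d S <= radial_measure v S)%E.
Proof.
move=> mS m0 hm; rewrite -integral_cst//; apply: ge0_le_integral => //.
by apply/measurable_EFinP; apply: measurable_funTS; exact: measurable_density.
Qed.

Lemma radial_measure_le_cst (S : set 'rV[R]_d) (m : R) : measurable S ->
  (forall x, S x -> density v x <= m) ->
  (radial_measure v S <= m%:E * lebesgue_rV d S)%E.
Proof.
move=> mS hm; rewrite -integral_cst//; apply: ge0_le_integral => //.
by apply/measurable_EFinP; apply: measurable_funTS; exact: measurable_density.
Qed.

End constant_bounds.

Section line.
Context {R : realType}.

Lemma enorm1 (x : 'rV[R]_1) : enorm x = `|x ord0 ord0|.
Proof. by rewrite /enorm /dotp big_ord1 -expr2 sqrtr_sqr. Qed.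

(** With u = 1 or u = -1 the two half-lines are treated at once. *)
Definition band (u : R) (i : interval R) : set 'rV[R]_1 := [set x | u * x ord0 ord0 \in i].

Lemma measurable_band u i : measurable (band u i).
Proof.
have mu : measurable_fun setT (fun x : 'rV[R]_1 => u * x ord0 ord0).
  by apply: measurable_funM => //; exact: (@measurable_rV_coord R 1 ord0).
by have := mu measurableT [set` i] (measurable_itv i); rewrite setTI.
Qed.

Lemma band_volume u b1 b2 (p q : R) : `|u| = 1 -> p <= q ->
  lebesgue_rV 1 (band u (Interval (BSide b1 p) (BSide b2 q))) = (q - p)%:E.
Proof.
move=> u1 pq; set i := Interval _ _.
have mu : measurable_fun setT (fun t : measurableTypeR R => u * t : measurableTypeR R).
  exact: mulrl_measurable.
have mA : measurable ((fun t : measurableTypeR R => u * t) @^-1` [set` i]).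
  by rewrite -[X in measurable X]setTI; exact: mu.
have -> : band u i = [set x | forall k : 'I_1,
    ((fun t : measurableTypeR R => u * t) @^-1` [set` i]) (x ord0 k)].
  apply/seteqP; split => x /=; last exact.
  by move=> h k; have -> : k = ord0 by rewrite (ord1 k); exact/val_inj.
rewrite (_ : lebesgue_rV 1 _ =
  lebesgue_measure ((fun t : measurableTypeR R => u * t) @^-1` [set` i])); last first.
  by rewrite (@lebesgue_rV_box R 1 (fun=> _ @^-1` _))// big_ord1.
have vol : lebesgue_measure ([set` i] : set R) = (q - p)%:E.
  rewrite lebesgue_measure_itv/= lte_fin; case: ltgtP pq => // -> _.
  by rewrite subrr.
have /orP[/eqP uE|/eqP uE] : (u == 1) || (u == -1).
  by move/eqP: u1; rewrite eqr_norml ler01 andbT.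
  rewrite -vol; congr lebesgue_measure; apply/seteqP.
  by split => t /=; rewrite uE mul1r.
rewrite -vol -(lebesgue_measureN (measurable_itv i)); congr lebesgue_measure; apply/seteqP.
by split => t /=; rewrite uE mulN1r.
Qed.

Section gap.
Variables (v : R -> R).
Hypothesis v_nd : forall r s, 0 < r -> r <= s -> v r <= v s.
Hypothesis v_der : forall r, 0 < r -> derivable v r 1.

Let mu := @radial_measure R 1 v.

Lemma enormB1 (x y : 'rV[R]_1) (u : R) : `|u| = 1 ->
  enorm (x - y) = `|u * x ord0 ord0 - u * y ord0 ord0|.
Proof. by move=> u1; rewrite enorm1 !mxE -mulrBr normrM u1 mul1r. Qed.

Lemma open_band u (p q : R) : `|u| = 1 -> open (band u `]p, q[).
Proof.
move=> u1; apply/open_enormP => x; rewrite /band/= in_itv/= => /andP[px xq].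
exists (Num.min (u * x ord0 ord0 - p) (q - u * x ord0 ord0)).
  by rewrite lt_min !subr_gt0 px.
move=> y; rewrite (enormB1 _ _ _ u1) lt_min !ltr_norml in_itv/=.
by move=> /andP[/andP[h1 h2] /andP[h3 h4]]; apply/andP; split; lra.
Qed.

(** Let a > 0 be the distance from 0 to the part of A on one of the half-lines,
   oriented by u. Filling the interval from - s0 to a, with s0 small, removes
   from the collar the interval just before a and adds an interval of the same
   length just before - s0. The latter is closer to the origin, where the
   density is smaller, so the collar loses mass while A gains some. *)
Lemma fill_gap (A : set 'rV[R]_1) : open A -> A !=set0 -> ~ closure A 0 ->
  mu A \is a fin_num -> exists2 A' : set 'rV[R]_1,
    [/\ open A', A' 0, mu A' \is a fin_num & (mu A <= mu A')%E] &
    exists2 e0, 0 < e0 & forall e, 0 < e -> e < e0 ->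
      (mu (enlargement A' e) - mu A' <= mu (enlargement A e) - mu A)%E.
Proof.
move=> oA [x1 Ax1] ncA finA.
have [dlt dlt0 hd] : exists2 dlt : R, 0 < dlt & forall x, A x -> dlt <= enorm x.
  apply: contrapT => no; apply: ncA => V /nbhs_enormP[e e0 eV].
  apply: contrapT => nAV; apply: no; exists e => // x Ax.
  rewrite leNgt; apply/negP => xe; apply: nAV; exists x; split => //.
  by apply: eV; rewrite subr0.
pose t (u : R) (x : 'rV[R]_1) := u * x ord0 ord0.
(* Orient the line so that A meets the positive half-line. *)
pose u : R := Num.sg (x1 ord0 ord0).
have x1n0 : x1 ord0 ord0 != 0.
  by rewrite -normr_gt0 -enorm1 (lt_le_trans dlt0)// hd.
have u1 : `|u| = 1 by rewrite normr_sg x1n0.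
have tx1 : t u x1 = `|x1 ord0 ord0| by rewrite /t /u normrEsg.
have dist x y : enorm (x - y) = `|t u x - t u y| by exact: enormB1.
have norm x : enorm x = `|t u x| by rewrite enorm1 /t normrM u1 mul1r.
pose S := [set r | exists2 x, A x & r = t u x /\ 0 < r].
have S1 : S `|x1 ord0 ord0| by exists x1 => //; split=> //; rewrite normr_gt0.
have S_lb : lbound S dlt.
  move=> r [x Ax [-> t0]]; have := hd _ Ax.
  by rewrite norm gtr0_norm.
have S_inf : has_inf S by split; [exists (t u x1); rewrite tx1|exists dlt].
pose a := inf S.
have da : dlt <= a by apply: lb_le_inf => //; exists `|x1 ord0 ord0|.
have gap x : A x -> t u x <= - dlt \/ a <= t u x.
  move=> Ax; have := hd _ Ax; rewrite norm; have [t0|t0] := leP (t u x) 0.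
    by rewrite ler0_norm// lerNr => h; left.
  by move=> _; right; apply: ge_inf; [case: S_inf|exists x].
have near_a eta : 0 < eta -> exists2 x, A x & a <= t u x /\ t u x < a + eta.
  move=> eta0; have [r [x Ax [rE r0]] ra] := inf_adherent eta0 S_inf.
  exists x => //; rewrite -rE; split => //.
  by apply: ge_inf; [case: S_inf|exists x].
(* With this value the interval next to - s0, for widths below s0, lies within
   dlt / 2 of the origin, whereas the one next to a lies beyond dlt / 2. *)
pose s0 := dlt / 4.
have s0_gt0 : 0 < s0 by exact: divr_gt0.
pose G := band u `]- s0, a[.
have inG x : G x = (- s0 < t u x < a) :> Prop by rewrite /G /band/= in_itv.
have oG : open G by exact: open_band.
have mA : measurable A by exact: open_measurable_rV.
have mG : measurable G by exact: measurable_band.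
have AG : A `&` G = set0.
  apply/seteqP; split => x // [Ax]; rewrite inG => /andP[h1 h2].
  by case: (gap _ Ax) => h3; move: h1 h2 h3 dlt0 da; rewrite /s0; clear; lra.
have a0 : 0 < a by exact: lt_le_trans da.
have finG : mu G \is a fin_num.
  have Ga : G `<=` eball 1 (a + s0).
    move=> x; rewrite inG /eball/= norm => /andP[h1 h2].
    by rewrite ler_norml; apply/andP; split; move: h1 h2 s0_gt0 a0; clear; lra.
  by rewrite /mu (radial_measureE _ v_nd v_der _ _ _ mG Ga)// addr_gt0.
have muA' : mu (A `|` G) = (mu A + mu G)%E by exact: radial_measureU.
exists (A `|` G).
  split.
  - exact: openU.
  - by right; rewrite inG /t mxE mulr0 a0 andbT oppr_lt0.
  - by rewrite muA' fin_numD finA.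
  - by rewrite muA' leeDl// radial_measure_ge0.
exists s0 => // e e0 es0.
have mAe : measurable (enlargement A e).
  by apply: open_measurable_rV; exact: open_enlargement.
pose K := enlargement A e `\` A.
have mK : measurable K by exact: measurableD.
pose Lf := band u `[(- (s0 + e)), (- s0)].
pose H := band u `](a - e), a[.
have mLf : measurable Lf by exact: measurable_band.
have mH : measurable H by exact: measurable_band.
have claim1 : enlargement (A `|` G) e `<=` (A `|` G) `|` ((K `\` G) `|` Lf).
  move=> x [y AGy xy].
  have [|nAG] := pselect ((A `|` G) x); first by left.
  right; have [Ax nG] : ~ A x /\ ~ G x by split => h; apply: nAG; [left|right].
  have inK : enlargement A e x -> (K `\` G) x by [].
  case: AGy => [Ay|Gy]; first by left; apply: inK; exists y.
  move: Gy; rewrite inG => /andP[y1 y2].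
  move: xy; rewrite dist ltr_norml => /andP[xy1 xy2].
  move: nG; rewrite inG => /negP; rewrite negb_and -!leNgt => /orP[xs|ax].
    by right; rewrite /Lf /band/= in_itv/= -/(t u x); apply/andP; split;
      move: y1 xs xy1 xy2; clear; lra.
  left; apply: inK; have [z Az [z1 z2]] := near_a _ e0.
  by exists z => //; rewrite dist ltr_norml; apply/andP; split;
    move: y2 ax xy1 xy2 z1 z2; clear; lra.
have claim2 : H `<=` K `&` G.
  move=> x; rewrite /H /band/= in_itv/= -/(t u x) => /andP[h1 h2].
  have Gx : G x by rewrite inG h2 andbT; move: h1 es0 da dlt0; rewrite /s0; clear; lra.
  split => //; split; last by move=> Ax; have : (A `&` G) x by []; rewrite AG.
  have ea : 0 < e - (a - t u x) by move: h1; clear; lra.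
  have [z Az [z1 z2]] := near_a _ ea.
  by exists z => //; rewrite dist ltr_norml; apply/andP; split;
    move: h2 e0 z1 z2; clear; lra.
have LfH : (mu Lf <= mu H)%E.
  have d2 : 0 < dlt / 2 by exact: divr_gt0.
  apply: (@le_trans _ _ ((expR (v (dlt / 2)))%:E * e%:E)%E).
    have -> : e%:E = lebesgue_rV 1 Lf.
      by rewrite band_volume//; [congr EFin; ring|move: e0; clear; lra].
    apply: radial_measure_le_cst => // x; rewrite /Lf /band/= in_itv/= -/(t u x) => /andP[h1 h2].
    rewrite ler_expR norm ler0_norm; last by move: h2 s0_gt0; clear; lra.
    by apply: v_nd; move: h1 h2 es0 s0_gt0; rewrite /s0; clear; lra.
  have -> : e%:E = lebesgue_rV 1 H.
    by rewrite band_volume//; [congr EFin; ring|move: e0; clear; lra].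
  apply: radial_measure_ge_cst => //.
  move=> x; rewrite /H /band/= in_itv/= -/(t u x) => /andP[h1 h2].
  rewrite ler_expR v_nd// norm.
  by rewrite (le_trans _ (ler_norm _))//; move: h1 es0 da dlt0; rewrite /s0; clear; lra.
have muKE : (mu (enlargement A e) - mu A = mu K)%E.
  have := radial_measureD v v_der _ _ mA mAe (sub_enlargement A e e0).
  by rewrite -/K => h; rewrite /mu h addeAC subee ?add0e.
rewrite muKE leeBlDl; last by rewrite muA' fin_numD finA.
have mKG : measurable (K `\` G) by exact: measurableD.
apply: (@le_trans _ _ (mu ((A `|` G) `|` ((K `\` G) `|` Lf)))).
  apply: le_radial_measure => //; last by do 2 apply: measurableU => //.
  by apply: open_measurable_rV; apply: open_enlargement.
apply: (le_trans (radial_measureU_le _ v_der _ _ _ _)); [exact: measurableU|exact: measurableU|].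
apply: leeD2l; apply: (le_trans (radial_measureU_le _ v_der _ _ mKG mLf)).
have mKG' : measurable (K `&` G) by exact: measurableI.
have -> : mu K = (mu (K `\` G) + mu (K `&` G))%E.
  rewrite /mu addeC -radial_measureU//; first by rewrite setUIDK.
  by apply/seteqP; split => x // [[_ Gx] [_ /(_ Gx)]].
apply: leeD2l; apply: (le_trans LfH).
exact: le_radial_measure.
Qed.

(** This excludes the empty set, which has no point to fill the gap from. *)
Lemma radial_measure_eball_gt0 (r : R) : 0 < r -> (0 < mu (eball 1 r))%E.
Proof.
move=> r0; have h : 0 < r / 2 by exact: divr_gt0.
pose i : interval R := `](r / 2), r[.
have pos : (0 < (expR (v (r / 2)))%:E * lebesgue_rV 1 (band 1 i))%E.
  rewrite /i band_volume ?normr1//; last by lra.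
  by rewrite -EFinM lte_fin mulr_gt0 ?expR_gt0//; lra.
apply: (lt_le_trans pos).
have mband := measurable_band 1 i.
apply: (@le_trans _ _ (mu (band 1 i))).
  apply: radial_measure_ge_cst => // x; rewrite /band/= /i in_itv/= mul1r => /andP[h1 h2].
  by rewrite ler_expR v_nd// enorm1 (le_trans (ltW h1))// ler_norm.
apply: le_radial_measure => //; first exact: measurable_eball.
move=> x; rewrite /band /eball/= /i in_itv/= mul1r enorm1 => /andP[h1 h2].
by rewrite ger0_norm ?ltW// (lt_trans h).
Qed.

End gap.

End line.

(** * The isoperimetric inequality *)

Theorem proposition6p7 (R : realType) (d : nat) (v f : R -> R) (r0 : R) :
  (0 < d)%N ->
  0 < r0 ->
  (forall r s, 0 < r -> r <= s -> v r <= v s) ->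
  (forall r, 0 < r -> derivable v r 1) ->
  smooth_halfline f ->
  (forall r, 0 <= r -> `|f r| <= 1) ->
  f r0 = 1 ->
  let F r := f^`()%classic r + f r * (v^`()%classic r + d.-1%:R / r) in
  (forall r s, 0 < r -> r <= s -> F r <= F s) ->
  let mu := @radial_measure R d v in
  forall A : set 'rV[R]_d,
    open A ->
    lipschitz_boundary A ->
    mu A = mu (eball d r0) ->
    (surface_measure mu (eball d r0) <= surface_measure mu A)%E.
Proof.
move=> d0 r0_gt0 v_nd v_der [g g_smooth fg] f_le1 fr0 F F_nd mu A oA _ muAB.
have g_der (r : R) : derivable g r 1 by exact: g_smooth 0 r.
have g_le1 r : 0 <= r -> `|g r| <= 1 by move=> rge0; rewrite -fg// f_le1.
have gr0 : g r0 = 1 by rewrite -fg// ltW.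
have FE (r : R) : 0 < r -> @radial_div R d v g r = F r.
  move=> r_gt0; rewrite /radial_div /F fg ?ltW//; congr (_ + _).
  rewrite !derive1E; apply: near_eq_derive; near=> z.
  by rewrite fg// ltW//; near: z; exact: lt_nbhsr.
have G_nd r s : 0 < r -> r <= s -> @radial_div R d v g r <= @radial_div R d v g s.
  by move=> r_gt0 rs; rewrite !FE// ?F_nd// (lt_le_trans r_gt0).
have finB : mu (eball d r0) \is a fin_num.
  by rewrite /mu (radial_measureE v v_nd v_der _ r0)//; exact: measurable_eball.
have key := surface_le_quotient v g r0 d0 r0_gt0 v_nd v_der g_der g_le1 gr0 G_nd.
(* The quotient of A is bounded below for every small e, not only in the limit. *)
suff [e0 e0_gt0 he0] : exists2 e0, 0 < e0 & forall e, 0 < e -> e < e0 ->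
    (surface_measure mu (eball d r0) <= (mu (enlargement A e) - mu A) * (e^-1)%:E)%E.
  rewrite [leRHS]/surface_measure limf_einfE.
  pose V := [set e : R | 0 < e < e0].
  have V0 : 0^'+ V.
    exists e0 => //= e; rewrite /ball/= sub0r normrN => ee0 e_gt0.
    by rewrite /V/= e_gt0 (le_lt_trans (ler_norm _)).
  apply: le_trans (ereal_sup_ubound _); last by exists V.
  apply: le_ereal_inf_tmp => _ [e /andP[e_gt0 ee0] <-].
  exact: he0.
have finA : mu A \is a fin_num by rewrite muAB.
have [tA|ntA] := pselect (harmless_origin g A).
  exists 1 => // e e_gt0 _; by apply: key => //; rewrite -/mu -muAB.
have d1 : d = 1%N.
  apply/eqP; rewrite eqn_leq d0 andbT leqNgt; apply/negP => d2.
  by apply: ntA; exact: Or31.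
have ncA : ~ closure A 0 by move=> cA; apply: ntA; exact: Or32.
clear F F_nd FE; subst d.
have A0 : A !=set0.
  apply/set0P/eqP => A0; have := radial_measure_eball_gt0 v v_nd v_der r0 r0_gt0.
  by rewrite -/mu -muAB A0 /mu /radial_measure integral_set0 ltxx.
(* The dimension is 1 and the origin is a source off the closure of A: compare
   the filled set with the ball. *)
have [A' [oA' A'0 finA' AA'] [e0 e0_gt0 he0]] := fill_gap v v_nd v_der A oA A0 ncA finA.
exists e0 => // e e_gt0 ee0.
have tA' : harmless_origin g A' by apply: Or32; exact: subset_closure.
apply: (le_trans (key A' e oA' e_gt0 finA' _ tA')); first by rewrite -/mu -muAB.
by apply: lee_wpmul2r; [rewrite lee_fin invr_ge0 ltW|exact: he0].
Unshelve. all: by end_near. Qed.
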